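(* Let $n,m\in\mathbb{N}^*$, $T,L>0$ and $0\le a<b\le L$. Let $A\in C^1_L([0,T]\times[0,L])^{n\times n}$ and $B\in C^1_L([0,T]\times[0,L])^{n\times m}$. Consider the linear control system $$ \left\{\begin{array}{l} y_t+y_x+A(t,x)y=B(t,x)\Theta,\quad (t,x)\in[0,T]\times[0,L],\\ y(t,L)=y(t,0),\quad t\in[0,T],\\ y(0,x)=y^0(x),\quad x\in[0,L], \end{array}\right.\qquad (S) $$ with state $y(t,\cdot):[0,L]\to\mathbb{R}^n$ and control $\Theta(t,\cdot):[0,L]\to\mathbb{R}^m$ subject to the constraint $\operatorname{supp}\Theta\subset[0,T]\times[a,b]$. System $(S)$ is exactly controllable at time $T$ if, and only if, the following two conditions hold: 1. $T>L-(b-a)$. 2. For every $x\in[0,L)$, the ODE $$ \left\{\begin{array}{l} \frac{d}{dt}z(t)=-A^x(t)z(t)+B^x(t)\psi(t),\quad t\in[0,T],\\ z(0)=z^0\in\mathbb{R}^n, \end{array}\right. $$ is controllable with controls $\psi\in C^1([0,T])^m$ such that $$ \psi\equiv 0\ \text{ in }\ [0,T]\setminus\Big(\bigcup_{k=k_{\min}(x,b)}^{k_{\max}(x,a)}[\tau_k(x,a),\tau_k(x,b)]\Big). $$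
   Context: Function spaces. For $k\in\mathbb{N}$ and $p\in\mathbb{N}^*$, $C^k_L([0,T]\times[0,L])^p$ (resp. $C^k_L([0,L])^p$) is the Banach space of $y\in C^k([0,T]\times[0,L])^p$ (resp. $y\in C^k([0,L])^p$) that are $L$-periodic with respect to $x$, i.e. $\partial_x^i y(t,0)=\partial_x^i y(t,L)$ for all $t\in[0,T]$, $0\le i\le k$ (resp. $y^{(i)}(0)=y^{(i)}(L)$ for $0\le i\le k$). Matrix-valued functions are treated entrywise. Well-posedness. For every $y^0\in C^1_L([0,L])^n$ and $\Theta\in C^1_L([0,T]\times[0,L])^m$, $(S)$ has a unique classical solution $y\in C^1_L([0,T]\times[0,L])^n$. Exact controllability. $(S)$ is exactly controllable at time $T$ if for every $y^0,y^1\in C^1_L([0,L])^n$ there exists $\Theta\in C^1_L([0,T]\times[0,L])^m$ with $\operatorname{supp}\Theta\subset[0,T]\times[a,b]$ such that the corresponding solution $y\in C^1_L([0,T]\times[0,L])^n$ of $(S)$ satisfies $y(T,x)=y^1(x)$ for all $x\in[0,L]$. ODE controllability. The ODE is controllable (with a given class of controls) if for every $z^0,z^1\in\mathbb{R}^n$ there is a control $\psi$ in that class such that the solution $z$ with $z(0)=z^0$ satisfies $z(T)=z^1$. Extended characteristics. For $k\in\mathbb{N}$, $c\in[0,L]$, $x\in[0,L)$, set $\tau_k(x,c)=0$ if $c-x+kL<0$; $\tau_k(x,c)=c-x+kL$ if $c-x+kL\in[0,T]$; $\tau_k(x,c)=T$ if $c-x+kL>T$. Further, $k_{\min}(x,c)=\lfloor\frac{-c+x}{L}\rfloor+1$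 (the smallest $k\in\mathbb{N}$ such that $c-x+kL>0$) and $k_{\max}(x,c)=\lceil\frac{T-c+x}{L}\rceil-1$ (the greatest integer $k$ such that $c-x+kL<T$). The extended characteristic $\overline{X}:[0,T]\times[0,L)\to[0,L]$ is $$ \overline{X}(t,x)=\begin{cases} t+x & \text{if } t\in[0,\tau_0(x,L)],\\ t-\tau_{k-1}(x,L) & \text{if } t\in(\tau_k(x,0),\tau_k(x,L)],\ k_{\min}(x,0)\le k\le k_{\max}(x,0).\end{cases} $$ (These intervals cover $[0,T]$; this is the line of speed $1$ issued from $x$ at time $0$, re-entering at $0$ each time it reaches $L$.) Finally $A^x(t)=A(t,\overline{X}(t,x))$ and $B^x(t)=B(t,\overline{X}(t,x))$ for $t\in[0,T]$. *)

(* Defs.v *)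
From HB Require Import structures.
From mathcomp Require Import all_boot all_order all_algebra.
From mathcomp Require Import all_classical all_reals all_analysis.

Set Implicit Arguments.
Unset Strict Implicit.
Unset Printing Implicit Defensive.

Import Order.TTheory GRing.Theory Num.Theory.
Import numFieldNormedType.Exports.

Local Open Scope classical_set_scope.
Local Open Scope ring_scope.

(* Functions on [0, T], [0, L] or [0, T] x [0, L] are total functions on R or
   R x R; every notion below only looks at their values on those sets.
   Derivatives are taken relative to the interval, hence are one-sided at its
   endpoints. *)

Definition diff_quot (R : realType) (f : R -> R) (t s : R) : R :=
  (f s - f t) / (s - t).

Definition derivable_in (R : realType) (D : set R) (f : R -> R) (t : R) : Prop :=
  cvg (diff_quot f t s @[s --> within D t^']).

Definition derive_in (R : realType) (D : set R) (f : R -> R) (t : R) : R :=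
  lim (diff_quot f t s @[s --> within D t^']).

Definition derivable_mx_in (R : realType) (p q : nat) (D : set R)
    (F : R -> 'M[R]_(p, q)) (t : R) : Prop :=
  forall i j, derivable_in D (fun s => F s i j) t.

Definition derive_mx_in (R : realType) (p q : nat) (D : set R)
    (F : R -> 'M[R]_(p, q)) (t : R) : 'M[R]_(p, q) :=
  \matrix_(i, j) derive_in D (fun s => F s i j) t.

Definition continuous_mx_in (X : topologicalType) (R : realType) (p q : nat)
    (D : set X) (F : X -> 'M[R]_(p, q)) : Prop :=
  forall i j, {within D, continuous (fun u => F u i j)}.

Definition rect (R : realType) (T L : R) : set (R * R) := `[0, T] `*` `[0, L].

Definition d_t (R : realType) (p q : nat) (T : R)
    (F : R -> R -> 'M[R]_(p, q)) (t x : R) : 'M[R]_(p, q) :=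
  derive_mx_in `[0, T] (fun s => F s x) t.

Definition d_x (R : realType) (p q : nat) (L : R)
    (F : R -> R -> 'M[R]_(p, q)) (t x : R) : 'M[R]_(p, q) :=
  derive_mx_in `[0, L] (F t) x.

Definition C1_seg (R : realType) (p q : nat) (T : R)
    (F : R -> 'M[R]_(p, q)) : Prop :=
  [/\ continuous_mx_in `[0, T] F,
      forall t : R, t \in `[0, T] -> derivable_mx_in `[0, T] F t
    & continuous_mx_in `[0, T] (derive_mx_in `[0, T] F)].

Definition C1_rect (R : realType) (p q : nat) (T L : R)
    (F : R -> R -> 'M[R]_(p, q)) : Prop :=
  [/\ continuous_mx_in (rect T L) (fun u => F u.1 u.2),
      forall t x : R, t \in `[0, T] -> x \in `[0, L] ->
        derivable_mx_in `[0, T] (fun s => F s x) t /\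
        derivable_mx_in `[0, L] (F t) x,
      continuous_mx_in (rect T L) (fun u => d_t T F u.1 u.2)
    & continuous_mx_in (rect T L) (fun u => d_x L F u.1 u.2)].

Definition C1per_seg (R : realType) (p q : nat) (L : R)
    (F : R -> 'M[R]_(p, q)) : Prop :=
  [/\ C1_seg L F, F 0 = F L
    & derive_mx_in `[0, L] F 0 = derive_mx_in `[0, L] F L].

Definition C1per_rect (R : realType) (p q : nat) (T L : R)
    (F : R -> R -> 'M[R]_(p, q)) : Prop :=
  C1_rect T L F /\
  (forall t : R, t \in `[0, T] -> F t 0 = F t L /\ d_x L F t 0 = d_x L F t L).

Definition control_support (R : realType) (m : nat) (T L : R)
    (Theta : R -> R -> 'cV[R]_m) : set (R * R) :=
  closure [set u | rect T L u /\ Theta u.1 u.2 <> 0].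

Definition solves_S (R : realType) (n m : nat) (T L : R)
    (A : R -> R -> 'M[R]_n) (B : R -> R -> 'M[R]_(n, m))
    (Theta : R -> R -> 'cV[R]_m) (y0 : R -> 'cV[R]_n)
    (y : R -> R -> 'cV[R]_n) : Prop :=
  [/\ forall t x : R, t \in `[0, T] -> x \in `[0, L] ->
        d_t T y t x + d_x L y t x + A t x *m y t x = B t x *m Theta t x,
      forall t : R, t \in `[0, T] -> y t L = y t 0
    & forall x : R, x \in `[0, L] -> y 0 x = y0 x].

Definition exactly_controllable (R : realType) (n m : nat) (T L a b : R)
    (A : R -> R -> 'M[R]_n) (B : R -> R -> 'M[R]_(n, m)) : Prop :=
  forall y0 y1 : R -> 'cV[R]_n, C1per_seg L y0 -> C1per_seg L y1 ->
  exists Theta : R -> R -> 'cV[R]_m,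
    [/\ C1per_rect T L Theta,
        control_support T L Theta `<=` `[0, T] `*` `[a, b]
      & exists y : R -> R -> 'cV[R]_n,
          [/\ C1per_rect T L y, solves_S T L A B Theta y0 y
            & forall x : R, x \in `[0, L] -> y T x = y1 x]].

Definition solves_ode (R : realType) (n m : nat) (T : R)
    (F : R -> 'M[R]_n) (G : R -> 'M[R]_(n, m)) (psi : R -> 'cV[R]_m)
    (z : R -> 'cV[R]_n) : Prop :=
  forall t : R, t \in `[0, T] ->
    derivable_mx_in `[0, T] z t /\
    derive_mx_in `[0, T] z t = F t *m z t + G t *m psi t.

Definition ode_controllable (R : realType) (n m : nat) (T : R)
    (F : R -> 'M[R]_n) (G : R -> 'M[R]_(n, m))
    (U : set (R -> 'cV[R]_m)) : Prop :=
  forall z0 z1 : 'cV[R]_n, exists2 psi, U psi &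
    exists z : R -> 'cV[R]_n, [/\ solves_ode T F G psi z, z 0 = z0 & z T = z1].

Definition tau (R : realType) (T L : R) (k : nat) (x c : R) : R :=
  let s := c - x + k%:R * L in
  if s < 0 then 0 else if s <= T then s else T.

(* kmax may be -1, so both bounds are integers. *)
Definition kmin (R : realType) (L x c : R) : int :=
  Num.floor ((- c + x) / L) + 1.

Definition kmax (R : realType) (T L x c : R) : int :=
  Num.ceil ((T - c + x) / L) - 1.

(* xget selects the index k of the piece containing t; it is unique since the
   pieces are disjoint, and k >= kmin L x 0 = 1, so k.-1 is a true
   predecessor. *)
Definition Xbar (R : realType) (T L t x : R) : R :=
  if t <= tau T L 0 x L then t + x
  else
    let k := xget 0%N [set k : nat |
      kmin L x 0 <= k%:Z <= kmax T L x 0 /\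
      tau T L k x 0 < t <= tau T L k x L] in
    t - tau T L k.-1 x L.

Definition active_times (R : realType) (T L a b x : R) : set R :=
  \bigcup_(k in [set k : nat | kmin L x b <= k%:Z <= kmax T L x a])
    `[tau T L k x a, tau T L k x b]%classic.

Definition ode_controls (R : realType) (m : nat) (T L a b x : R) :
    set (R -> 'cV[R]_m) :=
  [set psi | C1_seg T psi /\
     forall t : R, (`[0, T] `\` active_times T L a b x) t -> psi t = 0].

(* Main.v *)
(** Along the characteristic issued from [x], the system [(S)] is the controlled
    ODE with matrices [A^x] and [B^x].

    Necessity: for constant [y0] and [y1], restricting a trajectory of [(S)] and
    its control to a characteristic solves the ODE control problem. The condition
    [T > L - (b - a)] already follows from the controllability of the ODEs: when
    it fails, the characteristic issued from [b] (from [0] if [b = L]) has no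
    active time.

    Sufficiency: let [M] be the fundamental matrix of the ODE issued from [x], [N]
    its inverse, [eta] a [C^1] periodic function that is positive on [(a, b)] and
    zero elsewhere, and [W] the weighted Gramian, [W' = eta (N B)(N B)^T],
    [W(0) = 0]. Controllability of the ODE makes [W(T)] invertible, and
    [Theta = eta (N B)^T W(T)^-1 (N(T) y1 - y0)] steers [y0] to [y1] along every
    characteristic at once. It is of class [C^1] because [M], [N] and [W] are so in
    [x]: the difference quotient in [x], as a function of [t], [x] and the
    increment [h], solves a linear ODE whose coefficients extend continuously to
    [h = 0]. *)

Require Import Defs.
From HB Require Import structures.
From mathcomp Require Import all_boot all_order all_algebra.
From mathcomp Require Import all_classical all_reals all_analysis.
From mathcomp Require Import ring lra.
Import Order.TTheory GRing.Theory Num.Theory.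
Import numFieldNormedType.Exports.
Local Open Scope classical_set_scope.
Local Open Scope ring_scope.

Set Implicit Arguments.
Unset Strict Implicit.
Unset Printing Implicit Defensive.

(** * One-sided derivatives *)

(** The characteristic that re-enters at 0 jumps whenever it reaches [L], which obstructs
    differentiation along it. All data are therefore extended to the plane, periodically in x and
    frozen in t outside [[0, T]]: the characteristic issued from x becomes the straight line
    [x + t], and changing between (time, position) and (time, starting point) is a shear of speed 1
    or -1. Periodicity in x of the objects built there comes from uniqueness for the ODEs.

    The ODEs are solved for all starting points at once, with the parameter in an arbitrary
    topological space. Taking the pair (base point, increment) as parameter lets the same existence
    theorem produce the derivative in x.

    The weight [eta] gives the control its regularity and its support, since it already is C^1 and
    vanishes off [[a, b]]. The price is that it is positive only on the open interval, whereas ODE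
    controls may act on the closed active intervals; a density argument closes this gap. The
    trajectory of [(S)] is explicit, by variation of constants. *)

Definition isder (R : realType) (D : set R) (f : R -> R) (t l : R) : Prop :=
  diff_quot f t s @[s --> within D t^'] --> l.

Section Isder.
Variable R : realType.
Implicit Types (D : set R) (f g : R -> R) (t l : R).

(** Clearing the denominator makes the case [s = t] trivial, so later estimates need not exclude
    it. *)
Lemma isderP D f t l : isder D f t l <->
  forall e, 0 < e -> exists2 d, 0 < d &
    forall s, D s -> `|s - t| < d -> `|f s - f t - l * (s - t)| <= e * `|s - t|.
Proof.
split=> [H e e0|H].
  move/cvgrPdist_le: H => /(_ e e0).
  rewrite /within /= => /nbhs_ballP[d /= d0 H]; exists d => // s Ds sd.
  have [->|st] := eqVneq s t; first by rewrite !subrr mulr0 subrr normr0 mulr0.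
  have := H s; rewrite -ball_normE /= distrC => /(_ sd st Ds) {}H.
  have st0 : s - t != 0 by rewrite subr_eq0.
  have -> : f s - f t - l * (s - t) = - (l - diff_quot f t s) * (s - t).
    by rewrite /diff_quot; field.
  by rewrite normrM normrN ler_wpM2r.
apply/cvgrPdist_le => e e0; have [d d0 {}H] := H e e0.
apply/nbhs_ballP; exists d => //= s; rewrite -ball_normE /= distrC => sd st Ds.
have st0 : s - t != 0 by rewrite subr_eq0.
have := H s Ds sd.
have -> : f s - f t - l * (s - t) = - (l - diff_quot f t s) * (s - t).
  by rewrite /diff_quot; field.
by rewrite normrM normrN ler_pM2r// normr_gt0.
Qed.

Lemma isder_subset D D' f t l : D' `<=` D -> isder D f t l -> isder D' f t l.
Proof.
move=> sD /isderP H; apply/isderP => e /H[d d0 {}H]; exists d => // s /sD.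
exact: H.
Qed.

Lemma isder_eq D f g t l : D t -> (forall s, D s -> f s = g s) ->
  isder D f t l -> isder D g t l.
Proof.
move=> Dt fg /isderP H; apply/isderP => e /H[d d0 {}H]; exists d => // s Ds.
by rewrite -!fg//; exact: H.
Qed.

Lemma isder_cst D c t : isder D (fun=> c) t 0.
Proof.
apply/isderP => e e0; exists 1 => // s _ _.
by rewrite !subrr mul0r subrr normr0 mulr_ge0// ltW.
Qed.

Lemma isder_id D t : isder D id t 1.
Proof.
apply/isderP => e e0; exists 1 => // s _ _.
by rewrite mul1r subrr normr0 mulr_ge0// ltW.
Qed.

Lemma isder_cvg D f t l : isder D f t l -> f @ within D (nbhs t) --> f t.
Proof.
move=> /isderP H; apply/cvgrPdist_le => e e0.
have [d d0 {}H] := H 1 ltr01.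
have l0 : 0 < `|l| + 1 by rewrite ltr_wpDl.
apply/nbhs_ballP; exists (Num.min d (e / (`|l| + 1))) => /=.
  by rewrite lt_min d0 divr_gt0.
move=> s; rewrite -ball_normE /= distrC lt_min => /andP[sd se] Ds.
have := H s Ds sd; rewrite mul1r => {}H.
rewrite distrC (_ : f s - f t = (f s - f t - l * (s - t)) + l * (s - t)).
  2: by rewrite subrK.
rewrite (le_trans (ler_normD _ _))// normrM.
apply: (@le_trans _ _ ((`|l| + 1) * `|s - t|)); first by rewrite mulrDl mul1r addrC lerD2l.
by move: se; rewrite ltr_pdivlMr// mulrC => /ltW.
Qed.

Lemma isderD D f g t l k : isder D f t l -> isder D g t k ->
  isder D (fun s => f s + g s) t (l + k).
Proof.
move=> /isderP Hf /isderP Hg; apply/isderP => e e0.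
have e20 : 0 < e / 2 by rewrite divr_gt0.
have [d d0 {}Hf] := Hf _ e20; have [d' d'0 {}Hg] := Hg _ e20.
exists (Num.min d d') => [|s Ds]; first by rewrite lt_min d0.
rewrite lt_min => /andP[/(Hf s Ds) {}Hf /(Hg s Ds) {}Hg].
rewrite (_ : _ - _ = (f s - f t - l * (s - t)) + (g s - g t - k * (s - t))).
  2: by ring.
by rewrite (le_trans (ler_normD _ _))// [e]splitr mulrDl lerD.
Qed.

Lemma isderM D f g t l k : isder D f t l -> isder D g t k ->
  isder D (fun s => f s * g s) t (l * g t + f t * k).
Proof.
move=> Hf Hg.
have Hgt : g s @[s --> within D t^'] --> g t.
  apply: cvg_trans (isder_cvg Hg); apply: cvg_app => A.
  rewrite /within /=; apply: (@filterS _ (nbhs t) _) => s H _; exact: H.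
rewrite /isder (_ : diff_quot _ t =
    fun s => diff_quot f t s * g s + f t * diff_quot g t s).
  exact: cvgD (cvgM Hf Hgt) (cvgM (cvg_cst (f t)) Hg).
by apply/funext => s; rewrite /diff_quot; ring.
Qed.

Lemma isderN D f t l : isder D f t l -> isder D (fun s => - f s) t (- l).
Proof.
move=> H; have := isderM (isder_cst D (-1) t) H.
rewrite mul0r add0r mulN1r; congr (isder _ _ _ _).
by apply/funext => s; rewrite mulN1r.
Qed.

Lemma isderB D f g t l k : isder D f t l -> isder D g t k ->
  isder D (fun s => f s - g s) t (l - k).
Proof. by move=> Hf /isderN; exact: isderD. Qed.

Lemma isderZ D c f t l : isder D f t l -> isder D (fun s => c * f s) t (c * l).
Proof.
by move=> H; have := isderM (isder_cst D c t) H; rewrite mul0r add0r.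
Qed.

Lemma isder_sum D (I : Type) (r : seq I) (P : pred I) (f : I -> R -> R) t (l : I -> R) :
  (forall i, isder D (f i) t (l i)) ->
  isder D (fun s => \sum_(i <- r | P i) f i s) t (\sum_(i <- r | P i) l i).
Proof.
move=> H; elim: r => [|i r IH].
  rewrite big_nil; have -> : (fun s => \sum_(i <- [::] | P i) f i s) = fun=> 0.
    by apply/funext => s; rewrite big_nil.
  exact: isder_cst.
rewrite big_cons.
have -> : (fun s => \sum_(j <- i :: r | P j) f j s) =
    fun s => if P i then f i s + \sum_(j <- r | P j) f j s
             else \sum_(j <- r | P j) f j s.
  by apply/funext => s; rewrite big_cons.
by case: (P i) => //; exact: isderD.
Qed.

(** Were t isolated in [D], the punctured filter would be trivial and every number a derivative;
    hence the accumulation hypothesis. *)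
Lemma isder_uniq D f t l k :
  (forall d, 0 < d -> exists s, [/\ D s, s != t & `|s - t| < d]) ->
  isder D f t l -> isder D f t k -> l = k.
Proof.
move=> Dt /isderP Hl /isderP Hk; apply/eqP; rewrite -subr_eq0 -normr_le0.
apply/ler_addgt0Pr => e e0; rewrite add0r.
have e20 : 0 < e / 2 by rewrite divr_gt0.
have [d d0 {}Hl] := Hl _ e20; have [d' d'0 {}Hk] := Hk _ e20.
have [|s [Ds st]] := Dt (Num.min d d'); first by rewrite lt_min d0.
rewrite lt_min => /andP[/(Hl s Ds) {}Hl /(Hk s Ds) {}Hk].
have st0 : 0 < `|s - t| by rewrite normr_gt0 subr_eq0.
rewrite -(ler_pM2r st0) -normrM.
rewrite (_ : _ * _ = - (f s - f t - l * (s - t)) + (f s - f t - k * (s - t))).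
  2: by ring.
by rewrite (le_trans (ler_normD _ _))// normrN [e]splitr mulrDl lerD.
Qed.

(** At interior points this gives access to the mean value theorem, the monotonicity criterion and
    the chain rule, all stated for [is_derive]. *)
Lemma isder_derive D f t l : nbhs t D -> isder D f t l -> is_derive t 1 f l.
Proof.
move=> nD H; have {}H : h^-1 *: ((f \o shift t) (h *: (1 : R)) - f t) @[h --> 0^'] --> l.
  move: H => /isderP H; apply/cvgrPdist_le => e e0.
  have [d d0 {}H] := H e e0.
  have /nbhs_ballP[d' /= d'0 sD] := nD.
  apply/nbhs_ballP; exists (Num.min d d') => /=; first by rewrite lt_min d0.
  move=> h; rewrite -ball_normE /= sub0r normrN lt_min => /andP[hd hd'] h0.
  have := H (h + t).
  rewrite addrK => /(_ _ hd) {}H; have /H {}H : D (h + t).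
    by apply: sD; rewrite -ball_normE /= opprD addrCA subrr addr0 normrN.
  rewrite /= [h%:A]mulr1.
  have -> : l - h^-1 *: (f (h + t) - f t) = - h^-1 * (f (h + t) - f t - l * h).
    by rewrite /GRing.scale /=; field.
  rewrite normrM normrN normfV mulrC ler_pdivrMr//.
  by rewrite normr_gt0.
by split; [apply/cvg_ex; exists l | exact: cvg_lim H].
Qed.

Lemma derive_isder f t l : is_derive t 1 f l -> isder setT f t l.
Proof.
move=> [df <-]; apply/isderP => e e0.
have : h^-1 *: ((f \o shift t) (h *: (1 : R)) - f t) @[h --> 0^'] --> 'D_1 f t by exact: df.
move=> /cvgrPdist_le /(_ e e0) /nbhs_ballP[d /= d0 H]; exists d => // s _ sd.
have [->|st] := eqVneq s t; first by rewrite !subrr mulr0 subrr normr0 mulr0.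
have := H (s - t); rewrite -ball_normE /= sub0r normrN => /(_ sd).
have st0 : s - t != 0 by rewrite subr_eq0.
move=> /(_ st0); rewrite [_%:A]mulr1 subrK.
have -> : 'D_1 f t - (s - t)^-1 *: (f s - f t) =
   - (f s - f t - 'D_1 f t * (s - t)) / (s - t).
  by rewrite /GRing.scale /=; field.
by rewrite normrM normrN normfV ler_pdivrMr// normr_gt0.
Qed.

Lemma isder_shift f x c l : isder setT f (x + c) l ->
  isder setT (fun s => f (s + c)) x l.
Proof.
move=> /isderP H; apply/isderP => e /H[d d0 {}H]; exists d => // s _ sd.
have := H (s + c) I; rewrite (_ : s + c - (x + c) = s - x); last by ring.
exact.
Qed.

Lemma MVT_isder f df a b : a <= b ->
  (forall x, isder setT f x (df x)) ->
  exists2 c, a <= c <= b & f b - f a = df c * (b - a).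
Proof.
move=> ab H; have [x _||c] := @MVT_segment R f df a b ab.
- by apply: isder_derive (H x); exact: filterT.
- apply: continuous_subspaceT => x.
  have := isder_cvg (H x); apply: cvg_trans; apply: cvg_app => A.
  by rewrite /within /=; apply: (@filterS _ (nbhs x) _) => s; exact.
by rewrite in_itv /= => cab fE; exists c.
Qed.

End Isder.

(** * Primitives and joint continuity *)

Section Primitive.
Variable R : realType.

(** For [0 <= T], the projection of the line onto [[0, T]]. Composing with it makes a function known
    on [[0, T]] total and keeps it continuous. *)
Definition clamp (T t : R) : R := Num.max 0 (Num.min t T).

Lemma clamp_itv (T t : R) : 0 <= T -> 0 <= clamp T t <= T.
Proof. by move=> T0; rewrite /clamp le_max lexx /= ge_max T0 ge_min lexx orbT. Qed.

Lemma clamp_id (T t : R) : 0 <= t <= T -> clamp T t = t.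
Proof. by move=> /andP[t0 tT]; rewrite /clamp min_l// max_r. Qed.

Lemma clampK (T t : R) : 0 <= T -> clamp T (clamp T t) = clamp T t.
Proof. by move=> T0; rewrite clamp_id// clamp_itv. Qed.

Lemma clamp_continuous (T : R) : continuous (clamp T).
Proof.
move=> t; apply: (@continuous_max _ _ (fun=> 0) (fun s => Num.min s T)); first exact: cst_continuous.
by apply: (@continuous_min _ _ id (fun=> T)) => //; exact: cst_continuous.
Qed.

(** The parameter space is left general: it will be [R] for starting points and [R * R] for a
    starting point with an increment. *)
Definition jcont (P : topologicalType) (g : R -> P -> R) : Prop :=
  continuous (fun u : R * P => g u.1 u.2).

Section JointContinuity.
Variable P : topologicalType.
Implicit Types g h : R -> P -> R.

Lemma jcont_comp (X : topologicalType) g (f : X -> R) (k : X -> P) :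
  jcont g -> continuous f -> continuous k -> continuous (fun x => g (f x) (k x)).
Proof.
move=> cg cf ck x; apply: (@continuous_comp _ _ _ (fun x => (f x, k x)) (fun u => g u.1 u.2)).
  exact: cvg_pair (cf x) (ck x).
exact: cg.
Qed.

Lemma jcont_cst c : jcont (fun (_ : R) (_ : P) => c).
Proof. exact: cst_continuous. Qed.

Lemma jcontD g h : jcont g -> jcont h -> jcont (fun t p => g t p + h t p).
Proof. by move=> cg ch u; apply: cvgD; [exact: cg|exact: ch]. Qed.

Lemma jcontM g h : jcont g -> jcont h -> jcont (fun t p => g t p * h t p).
Proof. by move=> cg ch u; apply: cvgM; [exact: cg|exact: ch]. Qed.

Lemma jcontN g : jcont g -> jcont (fun t p => - g t p).
Proof. by move=> cg u; apply: cvgN; exact: cg. Qed.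

Lemma jcont_sum (I : Type) (r : seq I) (Q : pred I) (g : I -> R -> P -> R) :
  (forall i, jcont (g i)) -> jcont (fun t p => \sum_(i <- r | Q i) g i t p).
Proof.
move=> cg; elim: r => [|i r IH].
  rewrite (_ : (fun _ _ => _) = fun=> fun=> 0); first exact: jcont_cst.
  by apply/funext => t; apply/funext => p; rewrite big_nil.
rewrite (_ : (fun _ _ => _) = fun t p => if Q i
    then g i t p + \sum_(j <- r | Q j) g j t p else \sum_(j <- r | Q j) g j t p).
  by case: (Q i) => //; exact: jcontD.
by apply/funext => t; apply/funext => p; rewrite big_cons.
Qed.

Lemma jcont_slice g p : jcont g -> continuous (g^~ p).
Proof.
by move=> cg; apply: (jcont_comp cg); [move=> x; exact: cvg_id|exact: cst_continuous].
Qed.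

Lemma jcont_snd (f : P -> R) : continuous f -> jcont (fun (_ : R) p => f p).
Proof. by move=> cf u; apply: continuous_comp; [exact: cvg_snd|exact: cf]. Qed.

End JointContinuity.

Section Monotone.
Variable T : R.
Hypothesis T0 : 0 < T.
Implicit Types f g h : R -> R.

Lemma isder_within_continuous h h' :
  (forall t, 0 <= t <= T -> isder `[0, T] h t (h' t)) ->
  {within `[0, T], continuous h}.
Proof.
move=> H; apply/subspace_continuousP => t /=; rewrite in_itv /= => tT.
exact: isder_cvg (H t tT).
Qed.

Lemma isder_inner_derive h t l : 0 < t < T -> isder `[0, T] h t l ->
  is_derive t 1 h l.
Proof.
move=> tT; apply: isder_derive; apply: filterS (near_in_itvoo tT) => s.
by rewrite /= !in_itv /= => /andP[/ltW -> /ltW ->].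
Qed.

Lemma isder_ge0_homo h h' s t :
  (forall t, 0 <= t <= T -> isder `[0, T] h t (h' t)) ->
  (forall t, 0 <= t <= T -> 0 <= h' t) -> 0 <= s -> s <= t -> t <= T -> h s <= h t.
Proof.
move=> dh h0.
have dh' r : r \in `]0, T[%R -> is_derive r 1 h (h' r).
  rewrite in_itv /= => rT; apply: isder_inner_derive => //; apply: dh.
  by move: rT => /andP[/ltW -> /ltW ->].
apply: ger0_derive1_ndecr.
- by move=> r /dh'[].
- move=> r rT; rewrite derive1E; have [_ ->] := dh' r rT; apply: h0.
  by move: rT; rewrite in_itv /= => /andP[/ltW -> /ltW ->].
- exact: isder_within_continuous dh.
Qed.

Lemma isder_ge0_le h h' t : (forall t, 0 <= t <= T -> isder `[0, T] h t (h' t)) ->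
  (forall t, 0 <= t <= T -> 0 <= h' t) -> 0 <= t <= T -> h 0 <= h t.
Proof. by move=> dh h0 /andP[]; apply: isder_ge0_homo dh h0 (lexx _). Qed.

(** Both [g + f] and [g - f] have a nonnegative derivative. Every estimate on a primitive below goes
    through this comparison instead of an inequality between integrals. *)
Lemma isder_abs_le f g f' g' t :
  (forall t, 0 <= t <= T -> isder `[0, T] f t (f' t)) ->
  (forall t, 0 <= t <= T -> isder `[0, T] g t (g' t)) ->
  (forall t, 0 <= t <= T -> `|f' t| <= g' t) ->
  0 <= t <= T -> `|f t - f 0| <= g t - g 0.
Proof.
move=> df dg fg tT; rewrite ler_norml; apply/andP; split.
  have : g 0 + f 0 <= g t + f t.
    apply: (@isder_ge0_le (fun s => g s + f s) (fun s => g' s + f' s)) tT => s sT.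
      by apply: isderD; [exact: dg|exact: df].
    by have := fg s sT; rewrite ler_norml => /andP[]; rewrite lerNl -subr_ge0 opprK.
  by lra.
have : g 0 - f 0 <= g t - f t.
  apply: (@isder_ge0_le (fun s => g s - f s) (fun s => g' s - f' s)) tT => s sT.
    by apply: isderB; [exact: dg|exact: df].
  by have := fg s sT; rewrite ler_norml subr_ge0 => /andP[].
by lra.
Qed.

Lemma isder0_cst f t : (forall t, 0 <= t <= T -> isder `[0, T] f t 0) ->
  0 <= t <= T -> f t = f 0.
Proof.
move=> df tT; apply/eqP; rewrite -subr_eq0 -normr_le0.
have := @isder_abs_le f (fun=> 0) (fun=> 0) (fun=> 0) t df.
by rewrite subrr; apply=> // *; [exact: isder_cst|rewrite normr0].
Qed.

(** Each point of [[0, T]] is an accumulation point of it, from the right when [t < T] and from the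
    left at the endpoint [T]. *)
Lemma isder_seg_uniq f t l k : 0 <= t <= T ->
  isder `[0, T] f t l -> isder `[0, T] f t k -> l = k.
Proof.
move=> /andP[t0 tT]; apply: isder_uniq => d d0.
have [tT'|Tt] := ltP t T.
  exists (t + Num.min (d / 2) (T - t)).
  have m0 : 0 < Num.min (d / 2) (T - t) by rewrite lt_min divr_gt0 ?subr_gt0.
  have m1 : Num.min (d / 2) (T - t) <= d / 2 by rewrite ge_min lexx.
  have m2 : Num.min (d / 2) (T - t) <= T - t by rewrite ge_min lexx orbT.
  set m := Num.min _ _ in m0 m1 m2 *.
  split; first by rewrite /= in_itv /=; apply/andP; split; lra.
    by apply/eqP; lra.
  by rewrite (_ : t + m - t = m) ?gtr0_norm; lra.
exists (t - Num.min (d / 2) t).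
have m0 : 0 < Num.min (d / 2) t by rewrite lt_min divr_gt0//= (lt_le_trans T0).
have m1 : Num.min (d / 2) t <= d / 2 by rewrite ge_min lexx.
have m2 : Num.min (d / 2) t <= t by rewrite ge_min lexx orbT.
set m := Num.min _ _ in m0 m1 m2 *.
split; first by rewrite /= in_itv /=; apply/andP; split; lra.
  by apply/eqP; lra.
by rewrite (_ : t - m - t = - m) ?normrN ?gtr0_norm; lra.
Qed.

(* Freezing the primitive outside [0, T] keeps all solutions below total and
   jointly continuous on the whole of R * P; the lower bound -1 only serves to
   have t = 0 in the interior for the fundamental theorem of calculus. *)
Definition prim f t : R :=
  (\int[lebesgue_measure]_(s in `[-1, clamp T t]) f s -
   \int[lebesgue_measure]_(s in `[-1, (0 : R)]) f s)%R.

Lemma prim0 f : prim f 0 = 0.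
Proof. by rewrite /prim clamp_id ?lexx ?ltW// subrr. Qed.

Lemma prim_clamp f t : prim f (clamp T t) = prim f t.
Proof. by rewrite /prim clampK// ltW. Qed.

Lemma isder_prim f t : continuous f -> 0 <= t <= T ->
  isder `[0, T] (prim f) t (f t).
Proof.
(* [T + 1] does on the right what [-1] does on the left: every t of [[0, T]] is interior to the
   interval of integration. *)
move=> cf tT; have [||||] := @continuous_FTC1_closed R f (-1) t (T + 1).
- by move: tT => /andP[_ tT]; rewrite ltr_pwDr.
- apply: (@continuous_compact_integrable R f); first exact: segment_compact.
  exact: continuous_subspaceT.
- by move: tT => /andP[t0 _]; rewrite (lt_le_trans _ t0)// ltrN10.
- exact: cf.
set F := fun x => _; rewrite derive1E => dF DF.
have {dF DF} /derive_isder : is_derive t 1 F (f t) by split.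
move=> /(isder_subset (@subsetT _ `[0, T]%classic)) dF.
have := isderB dF (isder_cst `[0, T]%classic
  (\int[lebesgue_measure]_(s in `[-1, (0 : R)]) f s)%R t).
rewrite subr0; apply: isder_eq; first by rewrite /= in_itv.
by move=> s /=; rewrite in_itv /= => sT; rewrite /prim clamp_id.
Qed.

Lemma prim_dist f g e t : continuous f -> continuous g ->
  (forall s, 0 <= s <= T -> `|f s - g s| <= e) ->
  `|prim f t - prim g t| <= e * T.
Proof.
move=> cf cg fg; rewrite -(prim_clamp f) -(prim_clamp g).
have /andP[c0 cT] := clamp_itv t (ltW T0); set c := clamp T t in c0 cT *.
have e0 : 0 <= e.
  by rewrite (le_trans _ (fg 0 _))// lexx ltW.
have := @isder_abs_le (fun t => prim f t - prim g t) (fun t => e * t)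
  (fun t => f t - g t) (fun=> e * 1) c.
rewrite !prim0 subrr mulr0 !subr0 => H.
apply: (@le_trans _ _ (e * c)); last exact: ler_wpM2l.
apply: H => // [s sT|s sT|s sT|].
- by apply: isderB; exact: isder_prim.
- exact/isderZ/isder_id.
- by rewrite mulr1; exact: fg.
- by rewrite c0.
Qed.

Lemma prim_continuous f : continuous f -> continuous (prim f).
Proof.
move=> cf; have -> : prim f = prim f \o clamp T.
  by apply/funext => t; rewrite /= prim_clamp.
have cp : {within `[0, T], continuous (prim f)}.
  by apply: isder_within_continuous => t tT; exact: isder_prim.
move=> t.
have ct : (`[0, T]%classic (clamp T t)) by rewrite /= in_itv /= clamp_itv// ltW.
move/subspace_continuousP : cp => /(_ _ ct) cp.
rewrite /continuous_at; apply: cvg_comp cp => A.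
rewrite /within /= => H.
have := @clamp_continuous T t _ H; apply: (@filterS _ (nbhs t) _) => s /=; apply.
by rewrite in_itv /= clamp_itv// ltW.
Qed.

(** Compactness of [[0, T]] makes [g s p] close to [g s p0] uniformly in s once p is near [p0].
    Integration multiplies the error by at most [T], whence the tolerance [e / (2 * T)]; the other
    half of e pays for moving t at the fixed parameter [p0]. *)
Lemma jcont_prim (P : topologicalType) (g : R -> P -> R) :
  jcont g -> jcont (fun t p => prim (g^~ p) t).
Proof.
move=> cg [t0 p0]; apply/cvgrPdist_le => e e0.
have e1 : 0 < e / (2 * T) by rewrite divr_gt0// mulr_gt0.
have H1 : \forall p \near p0, `[0, T] `<=`
    (fun s => `|g s p - g s p0| <= e / (2 * T)).
  have /compact_near_coveringP := @segment_compact R 0 T.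
  move=> /(_ P (nbhs p0) (fun p s => `|g s p - g s p0| <= e / (2 * T)) _); apply.
  move=> s _.
  have e2 : 0 < e / (2 * T) / 2 by rewrite divr_gt0.
  have : \forall u \near (s, p0), `|g s p0 - g u.1 u.2| <= e / (2 * T) / 2.
    by move: (cg (s, p0)) => /cvgrPdist_le /(_ _ e2).
  have : \forall u \near (s, p0), `|g s p0 - g u.1 p0| <= e / (2 * T) / 2.
    have /(_ (s, p0)) : continuous (fun u : R * P => g u.1 p0).
      apply: (jcont_comp cg) => [x|]; [exact: cvg_fst|exact: cst_continuous].
    by move=> /cvgrPdist_le /(_ _ e2).
  apply: filterS2 => -[s' p] /= h1 h2.
  rewrite (_ : _ - _ = - (g s p0 - g s' p) + (g s p0 - g s' p0)).
    2: by ring.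
  by rewrite (le_trans (ler_normD _ _))// normrN [leRHS]splitr lerD.
have H2 : \forall t \near t0, `|prim (g^~ p0) t0 - prim (g^~ p0) t| <= e / 2.
  have /(_ t0)/cvgrPdist_le/(_ (e / 2)) := prim_continuous (@jcont_slice _ g p0 cg).
  by apply; rewrite divr_gt0.
exists ([set t | `|prim (g^~ p0) t0 - prim (g^~ p0) t| <= e / 2],
  [set p | `[0, T] `<=` (fun s => `|g s p - g s p0| <= e / (2 * T))]) => //.
move=> [t p] [/= h2 h1].
rewrite (_ : _ - _ = (prim (g^~ p0) t0 - prim (g^~ p0) t) -
  (prim (g^~ p) t - prim (g^~ p0) t)); last by ring.
rewrite (le_trans (ler_normB _ _))// [leRHS]splitr lerD//.
rewrite (_ : e / 2 = e / (2 * T) * T); last by field; rewrite gt_eqF.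
apply: prim_dist; [exact: jcont_slice|exact: jcont_slice|move=> s sT].
by apply: h1; rewrite /= in_itv.
Qed.

End Monotone.
End Primitive.

(** * Matrix calculus *)

Section MatrixCalculus.
Variable R : realType.

Definition mder (p q : nat) (D : set R) (Z : R -> 'M[R]_(p, q)) (t : R)
    (L : 'M[R]_(p, q)) : Prop :=
  forall i j, isder D (fun s => Z s i j) t (L i j).

Definition jcontmx (P : topologicalType) (p q : nat) (F : R -> P -> 'M[R]_(p, q)) : Prop :=
  forall i j, jcont (fun t x => F t x i j).

Lemma mderD p q D (Z1 Z2 : R -> 'M[R]_(p, q)) t L1 L2 :
  mder D Z1 t L1 -> mder D Z2 t L2 -> mder D (fun s => Z1 s + Z2 s) t (L1 + L2).
Proof.
move=> H1 H2 i j; rewrite mxE (_ : (fun _ => _) = fun s => Z1 s i j + Z2 s i j).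
  exact: isderD.
by apply/funext => s; rewrite mxE.
Qed.

Lemma mderN p q D (Z : R -> 'M[R]_(p, q)) t L :
  mder D Z t L -> mder D (fun s => - Z s) t (- L).
Proof.
move=> H i j; rewrite mxE (_ : (fun _ => _) = fun s => - Z s i j).
  exact: isderN.
by apply/funext => s; rewrite mxE.
Qed.

Lemma mderB p q D (Z1 Z2 : R -> 'M[R]_(p, q)) t L1 L2 :
  mder D Z1 t L1 -> mder D Z2 t L2 -> mder D (fun s => Z1 s - Z2 s) t (L1 - L2).
Proof. by move=> H1 /mderN; exact: mderD. Qed.

Lemma mderM p q r D (Z1 : R -> 'M[R]_(p, q)) (Z2 : R -> 'M[R]_(q, r)) t L1 L2 :
  mder D Z1 t L1 -> mder D Z2 t L2 ->
  mder D (fun s => Z1 s *m Z2 s) t (L1 *m Z2 t + Z1 t *m L2).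
Proof.
move=> H1 H2 i j.
rewrite (_ : (fun _ => _) = fun s => \sum_k Z1 s i k * Z2 s k j); last first.
  by apply/funext => s; rewrite mxE.
rewrite !mxE -big_split /=; apply: isder_sum => k; exact: isderM.
Qed.

Lemma mder_tr p q D (Z : R -> 'M[R]_(p, q)) t L :
  mder D Z t L -> mder D (fun s => (Z s)^T) t L^T.
Proof.
move=> H i j; rewrite mxE (_ : (fun _ => _) = fun s => Z s j i)//.
by apply/funext => s; rewrite mxE.
Qed.

Lemma mder_cst p q D (M : 'M[R]_(p, q)) t : mder D (fun=> M) t 0.
Proof. by move=> i j; rewrite mxE; exact: isder_cst. Qed.

Lemma mder_eq p q (D : set R) (Z Z' : R -> 'M[R]_(p, q)) t L : D t ->
  (forall s, D s -> Z s = Z' s) -> mder D Z t L -> mder D Z' t L.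
Proof.
move=> Dt ZZ H i j; apply: isder_eq (H i j) => // s Ds; by rewrite ZZ.
Qed.

Lemma mder0_cst p q (T : R) (Z : R -> 'M[R]_(p, q)) t :
  (forall t, 0 <= t <= T -> mder `[0, T] Z t 0) -> 0 <= t <= T -> Z t = Z 0.
Proof.
move=> dZ tT; apply/matrixP => i j.
have /= := @isder0_cst R T (fun s => Z s i j) t; apply=> // s sT.
by have := dZ s sT i j; rewrite mxE.
Qed.

Section JointContinuityMx.
Variable P : topologicalType.

Lemma jcontmxD p q (F G : R -> P -> 'M[R]_(p, q)) :
  jcontmx F -> jcontmx G -> jcontmx (fun t x => F t x + G t x).
Proof.
move=> cF cG i j; rewrite (_ : (fun _ _ => _) = fun t x => F t x i j + G t x i j).
  exact: jcontD.
by apply/funext => t; apply/funext => x; rewrite mxE.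
Qed.

Lemma jcontmxN p q (F : R -> P -> 'M[R]_(p, q)) :
  jcontmx F -> jcontmx (fun t x => - F t x).
Proof.
move=> cF i j; rewrite (_ : (fun _ _ => _) = fun t x => - F t x i j).
  exact: jcontN.
by apply/funext => t; apply/funext => x; rewrite mxE.
Qed.

Lemma jcontmxM p q r (F : R -> P -> 'M[R]_(p, q)) (G : R -> P -> 'M[R]_(q, r)) :
  jcontmx F -> jcontmx G -> jcontmx (fun t x => F t x *m G t x).
Proof.
move=> cF cG i j.
rewrite (_ : (fun _ _ => _) = fun t x => \sum_k F t x i k * G t x k j).
  by apply: jcont_sum => k; exact: jcontM.
by apply/funext => t; apply/funext => x; rewrite mxE.
Qed.

Lemma jcontmx_tr p q (F : R -> P -> 'M[R]_(p, q)) :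
  jcontmx F -> jcontmx (fun t x => (F t x)^T).
Proof.
move=> cF i j; rewrite (_ : (fun _ _ => _) = fun t x => F t x j i)//.
by apply/funext => t; apply/funext => x; rewrite mxE.
Qed.

Lemma jcontmx_cst p q (M : 'M[R]_(p, q)) : jcontmx (fun _ (_ : P) => M).
Proof. by move=> i j; exact: jcont_cst. Qed.

Lemma jcont_uniform_limit (g : R -> P -> R) :
  (forall e, 0 < e -> exists2 h, jcont h & forall t p, `|g t p - h t p| <= e) -> jcont g.
Proof.
move=> H u; apply/cvgrPdist_le => e e0.
have e3 : 0 < e / 3 by rewrite divr_gt0.
have [h ch gh] := H _ e3.
have := ch u; move/cvgrPdist_le => /(_ _ e3); apply: filterS => v hv.
rewrite (_ : _ - _ = (g u.1 u.2 - h u.1 u.2) + (h u.1 u.2 - h v.1 v.2)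
   - (g v.1 v.2 - h v.1 v.2)); last by ring.
rewrite (le_trans (ler_normB _ _))// (_ : e = e / 3 + e / 3 + e / 3); last by field.
by rewrite lerD// (le_trans (ler_normD _ _))// lerD.
Qed.

End JointContinuityMx.
End MatrixCalculus.

(** * Limits of sequences with geometric increments *)

Section HalfPowers.
Variable R : realType.

Lemma half_pow_small (K e : R) : 0 < e -> exists k, K / 2 ^+ k <= e.
Proof.
move=> e0; have [K0|K0] := leP K 0.
  by exists 0%N; rewrite expr0 divr1 (le_trans K0)// ltW.
have Ke : 0 <= K / e by rewrite divr_ge0// ltW.
exists (Num.bound (K / e)).
have := archi_boundP Ke; set k := Num.bound _ => Kk.
have k2 : k%:R <= 2 ^+ k :> R by rewrite -natrX ler_nat ltnW// ltn_expl.
rewrite ler_pdivrMr ?exprn_gt0// mulrC -ler_pdivrMr//.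
by rewrite (le_trans (ltW Kk)).
Qed.

(** The tail of the series of increments is at most [2 * K / 2 ^+ k], so [u k] minus this bound
    increases, [u k] plus it decreases, and the intervals are nested. The supremum is an explicit
    term for the limit, so it can be taken pointwise in t and in the parameter with a uniform
    error. *)
Lemma half_pow_cauchy (u : nat -> R) (K : R) :
  (forall k, `|u k.+1 - u k| <= K / 2 ^+ k) ->
  forall k, `|u k - sup (range (fun k => u k - 2 * K / 2 ^+ k))| <= 2 * K / 2 ^+ k.
Proof.
move=> du; set v := fun k => _; set w := fun k => u k + 2 * K / 2 ^+ k.
have hp k : 2 * K / 2 ^+ k.+1 = K / 2 ^+ k.
  by rewrite exprS; field; rewrite expf_neq0.
have K0 : 0 <= K by have := du 0%N; rewrite expr0 divr1; exact: le_trans.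
have vS k : v k <= v k.+1.
  rewrite /v hp; have := du k; rewrite ler_norml => /andP[+ _].
  by rewrite -mulrA; lra.
have wS k : w k.+1 <= w k.
  rewrite /w hp; have := du k; rewrite ler_norml => /andP[_].
  by rewrite -mulrA; lra.
have vm : {homo v : i j / (i <= j)%N >-> i <= j}.
  by apply: homo_leq => [//|y x z|//]; exact: le_trans.
have wm i j : (i <= j)%N -> w j <= w i.
  by elim: j => [|j IH]; [rewrite leqn0 => /eqP ->|
    rewrite leq_eqVlt => /predU1P[->//|/IH]; exact: le_trans (wS j)].
have vw k : v k <= w k.
  by rewrite /v /w lerD2l ge0_cp// divr_ge0 ?exprn_ge0 ?mulr_ge0.
have vwij i j : v i <= w j.
  have [ij|/ltnW ji] := leqP i j; first exact: le_trans (vm _ _ ij) (vw j).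
  exact: le_trans (vw i) (wm _ _ ji).
move=> k; rewrite ler_distl; apply/andP; split.
  have : sup (range v) <= w k by apply: ge_sup; [exists (v 0%N); exists 0%N|move=> _ [i _ <-]].
  by rewrite /w; lra.
have : v k <= sup (range v).
  by apply: ub_le_sup; [exists (w 0%N) => _ [i _ <-]|exists k].
by rewrite {1}/v; lra.
Qed.

End HalfPowers.

(** * Linear differential equations with a parameter *)

Section LinearOde.
Variables (R : realType) (T : R).
Hypothesis T0 : 0 < T.

(** One bound serves all times and all parameters, so that Picard iterates converge uniformly and
    the limit stays jointly continuous. *)
Definition bounded_mx (P : Type) (p q : nat) (F : R -> P -> 'M[R]_(p, q)) : Prop :=
  exists C, forall t x i j, `|F t x i j| <= C.

Lemma mxBE (p q : nat) (A B : 'M[R]_(p, q)) i j : (A - B) i j = A i j - B i j.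
Proof. by rewrite !mxE. Qed.

Lemma mulmx_bound (p q r : nat) (A : 'M[R]_(p, q)) (B : 'M[R]_(q, r)) C K i j :
  (forall i j, `|A i j| <= C) -> (forall i j, `|B i j| <= K) ->
  `|(A *m B) i j| <= q%:R * (C * K).
Proof.
move=> HA HB; rewrite mxE (le_trans (ler_norm_sum _ _ _))//.
rewrite (@le_trans _ _ (\sum_(k < q) C * K))//.
  by apply: ler_sum => k _; rewrite normrM ler_pM.
by rewrite sumr_const card_ord mulr_natl.
Qed.

Variable P : topologicalType.
Section Existence.
Variables (n q : nat) (F : R -> P -> 'M[R]_n) (G : R -> P -> 'M[R]_(n, q)).
Variable M0 : 'M[R]_(n, q).
Hypotheses (cF : jcontmx F) (cG : jcontmx G).
Variables CF CG : R.
Hypothesis bF : forall t x i j, `|F t x i j| <= CF.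
Hypothesis bG : forall t x i j, `|G t x i j| <= CG.

Definition picard_step (X : R -> P -> 'M[R]_(n, q)) t x : 'M[R]_(n, q) :=
  \matrix_(i, j) (M0 i j + prim T (fun s => (F s x *m X s x + G s x) i j) t).

Let X k := iter k picard_step (fun _ _ => 0).

Let cX k : jcontmx (X k).
Proof.
elim: k => [|k IH]; first exact: jcontmx_cst.
move=> i j; rewrite (_ : (fun _ _ => _) = fun t x =>
    M0 i j + prim T ((fun s x => (F s x *m X k s x + G s x) i j)^~ x) t).
  by apply: jcontD; [exact: jcont_cst|apply: jcont_prim => //; exact: (jcontmxD (jcontmxM cF IH) cG)].
by apply/funext => t; apply/funext => x; rewrite /= mxE.
Qed.

(** [K0] bounds the first iterate, the zeroth being 0. The summand 1 in [C] makes it positive. *)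
Let K0 : R := \sum_i \sum_j `|M0 i j| + `|CG| * T.
Let C : R := n%:R * `|CF| + 1.
(* For the weight [w], the Picard map is a contraction of ratio 1/2. *)
Let w (t : R) : R := expR (2 * C * t).

Let C0 : 0 < C.
Proof. by rewrite ltr_wpDl. Qed.

Let dw t : isder `[0, T] w t (2 * C * w t).
Proof.
have d1 : is_derive t 1 (fun s => 2 * C * s) (2 * C).
  have := @isderZ R setT (2 * C) id t 1 (@isder_id R setT t); rewrite mulr1.
  by apply: isder_derive; exact: (@filterT _ (nbhs t)).
have := is_derive1_comp (is_derive_expR (2 * C * t)) d1.
by move=> /derive_isder/(isder_subset (@subsetT _ _)); rewrite [_ * (2 * C)]mulrC.
Qed.

Let M0_bound i j : `|M0 i j| <= \sum_i \sum_j `|M0 i j|.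
Proof.
rewrite (bigD1 i) //= (bigD1 j) //= -addrA lerDl addr_ge0 //.
  by apply: sumr_ge0.
by apply: sumr_ge0 => ? _; apply: sumr_ge0.
Qed.

Let K00 : 0 <= K0.
Proof.
apply: addr_ge0; last by rewrite mulr_ge0// ltW.
by apply: sumr_ge0 => ? _; apply: sumr_ge0.
Qed.

Let XS k x i j : continuous (fun s => (F s x *m X k s x + G s x) i j).
Proof. by have /(_ i j) := jcontmxD (jcontmxM cF (@cX k)) cG; exact: jcont_slice. Qed.

(** By induction the derivative of the next increment is at most [C * (K0 / 2 ^+ k * w)], which is
    exactly the derivative of [K0 / 2 ^+ k.+1 * w] since [w' = 2 * C * w]. The factor 2 in the
    exponent is what halves the constant. *)
Let dX_seg k t x i j : 0 <= t <= T ->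
  `|X k.+1 t x i j - X k t x i j| <= K0 / 2 ^+ k * w t.
Proof.
elim: k t i j => [|k IH] t i j tT.
  rewrite /= !mxE subr0 expr0 divr1.
  apply: (@le_trans _ _ (K0 * 1)); last first.
    rewrite ler_wpM2l// -expR0 ler_expR !mulr_ge0//; [exact: ltW|by case/andP: tT].
  rewrite mulr1 (le_trans (ler_normD _ _))// lerD//.
  have := @prim_dist R T T0 (fun s => (F s x *m 0 + G s x) i j) (fun=> 0) `|CG| t.
  have -> : prim T (fun=> 0 : R) t = 0.
    rewrite -(prim_clamp T0); apply: etrans (prim0 T0 (fun=> 0)).
    apply: isder0_cst (clamp_itv _ (ltW T0)) => s sT.
    exact: isder_prim (@cst_continuous _ _ _) sT.
  rewrite subr0; apply.
  - exact: (@XS 0).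
  - exact: cst_continuous.
  - by move=> s sT; rewrite subr0 mulmx0 add0r (le_trans (bG _ _ _ _))// ler_norm.
have -> : X k.+2 t x i j - X k.+1 t x i j =
   prim T (fun s => (F s x *m X k.+1 s x + G s x) i j) t -
   prim T (fun s => (F s x *m X k s x + G s x) i j) t.
  by rewrite /= [in LHS]mxE [in X in _ - X]mxE; ring.
have := @isder_abs_le R T (fun t =>
   prim T (fun s => (F s x *m X k.+1 s x + G s x) i j) t -
   prim T (fun s => (F s x *m X k s x + G s x) i j) t)
   (fun t => K0 / 2 ^+ k.+1 * w t)
   (fun s => (F s x *m X k.+1 s x + G s x) i j - (F s x *m X k s x + G s x) i j)
   (fun s => K0 / 2 ^+ k.+1 * (2 * C * w s)) t.
rewrite !(prim0 T0) subrr subr0 => H.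
apply: le_trans (H _ _ _ tT) _ => [s sT|s sT|s sT|].
- by apply: isderB; apply: isder_prim.
- by apply: isderZ; exact: dw.
- have -> : (F s x *m X k.+1 s x + G s x) i j - (F s x *m X k s x + G s x) i j =
     (F s x *m (X k.+1 s x - X k s x)) i j.
    by rewrite mulmxBr !mxE; ring.
  apply: (@le_trans _ _ (n%:R * (`|CF| * (K0 / 2 ^+ k * w s)))).
    apply: mulmx_bound => i' j'; first by rewrite (le_trans (bF _ _ _ _))// ler_norm.
    by rewrite mxBE; exact: IH.
  have -> : K0 / 2 ^+ k.+1 * (2 * C * w s) = C * (K0 / 2 ^+ k * w s).
    by rewrite exprS; field; rewrite expf_neq0.
  rewrite mulrA; apply: ler_wpM2r; last by rewrite lerDl.
  by apply: mulr_ge0 (expR_ge0 _); apply: mulr_ge0 => //; rewrite invr_ge0 exprn_ge0.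
by rewrite gerBl; apply: mulr_ge0 (expR_ge0 _); apply: mulr_ge0 => //; rewrite invr_ge0 exprn_ge0.
Qed.

Let X_clamp k t x : X k (clamp T t) x = X k t x.
Proof.
by case: k => //= k; apply/matrixP => i j; rewrite !mxE prim_clamp.
Qed.

Let K1 : R := K0 * w T.

Let dX k t x i j : `|X k.+1 t x i j - X k t x i j| <= K1 / 2 ^+ k.
Proof.
rewrite -(X_clamp k.+1) -(X_clamp k).
have cT := clamp_itv t (ltW T0).
rewrite (le_trans (dX_seg _ _ _ _ cT))// /K1 mulrAC.
apply: ler_wpM2r; first by rewrite invr_ge0 exprn_ge0.
apply: ler_wpM2l => //; rewrite ler_expR; apply: ler_wpM2l.
  exact: mulr_ge0 (ler0n _ 2) (ltW C0).
by case/andP: cT.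
Qed.

Let Y t x : 'M[R]_(n, q) :=
  \matrix_(i, j) sup (range (fun k => X k t x i j - 2 * K1 / 2 ^+ k)).

Let XY k t x i j : `|X k t x i j - Y t x i j| <= 2 * K1 / 2 ^+ k.
Proof.
rewrite mxE; apply: (@half_pow_cauchy R (fun k => X k t x i j) K1) => m.
exact: dX.
Qed.

Let K10 : 0 <= K1. Proof. by rewrite mulr_ge0 ?expR_ge0. Qed.

Let K20 : 0 <= 2 * K1. Proof. exact: mulr_ge0 (ler0n _ 2) K10. Qed.

Let cY : jcontmx Y.
Proof.
move=> i j; apply: jcont_uniform_limit => e e0.
have [k ke] := half_pow_small (2 * K1) e0.
exists (fun t x => X k t x i j); first exact: cX.
by move=> t x; rewrite distrC (le_trans (XY _ _ _ _ _)).
Qed.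

Let Y_eq t x i j : Y t x i j =
  M0 i j + prim T (fun s => (F s x *m Y s x + G s x) i j) t.
Proof.
apply/eqP; rewrite -subr_eq0 -normr_le0; apply/ler_addgt0Pr => e e0.
rewrite add0r.
(* The first summand bounds the distance from [X k.+1] to [Y], the second the distance between the
   primitives of the right-hand sides taken at [X k] and at [Y]. *)
have [k] := half_pow_small (2 * K1 + n%:R * (`|CF| * (2 * K1)) * T) e0.
apply: le_trans.
set B := prim _ _ _.
have cYx : continuous (fun s => (F s x *m Y s x + G s x) i j).
  by have /(_ i j) := jcontmxD (jcontmxM cF cY) cG; exact: jcont_slice.
have -> : Y t x i j - (M0 i j + B) = - (X k.+1 t x i j - Y t x i j) +
    (prim T (fun s => (F s x *m X k s x + G s x) i j) t - B).
  by rewrite /= [in RHS]mxE; ring.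
rewrite (le_trans (ler_normD _ _))// mulrDl lerD//.
  rewrite normrN (le_trans (XY _ _ _ _ _))//; apply: ler_wpM2l => //.
  by rewrite lef_pV2 ?posrE ?exprn_gt0// exprS ler_peMl ?exprn_ge0// ler1n.
rewrite (_ : _ / 2 ^+ k = n%:R * (`|CF| * (2 * K1 / 2 ^+ k)) * T); last by ring.
apply: prim_dist => //.
move=> s sT.
have -> : (F s x *m X k s x + G s x) i j - (F s x *m Y s x + G s x) i j =
    (F s x *m (X k s x - Y s x)) i j.
  by rewrite mulmxBr !mxE; ring.
apply: mulmx_bound => i' j'; first by rewrite (le_trans (bF _ _ _ _))// ler_norm.
by rewrite mxBE; exact: XY.
Qed.

Lemma linear_ode_aux : exists Y : R -> P -> 'M[R]_(n, q),
  [/\ jcontmx Y, bounded_mx Y, forall x, Y 0 x = M0,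
      forall t x, Y (clamp T t) x = Y t x &
      forall t x, 0 <= t <= T ->
        mder `[0, T] (Y^~ x) t (F t x *m Y t x + G t x)].
Proof.
exists Y; split.
- exact: cY.
- exists (2 * K1) => t x i j.
  by have := XY 0 t x i j; rewrite /= mxE sub0r normrN expr0 divr1.
- by move=> x; apply/matrixP => i j; rewrite Y_eq prim0// addr0.
- by move=> t x; apply/matrixP => i j; rewrite !Y_eq prim_clamp.
- move=> t x tT i j.
  rewrite (_ : (fun s => _) = fun s =>
     M0 i j + prim T (fun s => (F s x *m Y s x + G s x) i j) s).
    rewrite -[X in isder _ _ _ X]add0r; apply: isderD; first exact: isder_cst.
    have := @isder_prim R T (fun s => (F s x *m Y s x + G s x) i j) t.
    apply=> //; by have /(_ i j) := jcontmxD (jcontmxM cF cY) cG; exact: jcont_slice.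
  by apply/funext => s; exact: Y_eq.
Qed.

End Existence.

Theorem linear_ode (n q : nat) (F : R -> P -> 'M[R]_n) (G : R -> P -> 'M[R]_(n, q))
    (M0 : 'M[R]_(n, q)) :
  jcontmx F -> jcontmx G -> bounded_mx F -> bounded_mx G ->
  exists Y : R -> P -> 'M[R]_(n, q),
  [/\ jcontmx Y, bounded_mx Y, forall x, Y 0 x = M0,
      forall t x, Y (clamp T t) x = Y t x &
      forall t x, 0 <= t <= T ->
        mder `[0, T] (Y^~ x) t (F t x *m Y t x + G t x)].
Proof.
by move=> cF cG [CF bF] [CG bG]; exact: (@linear_ode_aux n q F G M0 cF cG CF CG bF bG).
Qed.

(** The derivative of [Z Y] is [- Z F Y + Z F Y = 0], so the product keeps its initial value; a left
    inverse of a square matrix is also a right inverse. *)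
Lemma linear_ode_inverse (n : nat) (F : R -> P -> 'M[R]_n)
    (Y Z : R -> P -> 'M[R]_n) t x : 
  Y 0 x = 1%:M -> Z 0 x = 1%:M ->
  (forall t, 0 <= t <= T -> mder `[0, T] (Y^~ x) t (F t x *m Y t x)) ->
  (forall t, 0 <= t <= T -> mder `[0, T] (Z^~ x) t (- (Z t x *m F t x))) ->
  0 <= t <= T -> Z t x *m Y t x = 1%:M /\ Y t x *m Z t x = 1%:M.
Proof.
move=> Y0 Z0 dY dZ tT.
have ZY : Z t x *m Y t x = 1%:M.
  have /(_ t) := @mder0_cst R n n T (fun t => Z t x *m Y t x).
  rewrite Y0 Z0 mulmx1; apply=> // s sT.
  have := mderM (dZ s sT) (dY s sT).
  by rewrite mulNmx mulmxA addrC subrr.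
by split=> //; exact: mulmx1C.
Qed.

Theorem fundamental_matrix (n : nat) (F : R -> P -> 'M[R]_n) :
  jcontmx F -> bounded_mx F ->
  exists Y Z : R -> P -> 'M[R]_n,
  [/\ [/\ jcontmx Y, bounded_mx Y, (forall x, Y 0 x = 1%:M) &
      forall t x, 0 <= t <= T -> mder `[0, T] (Y^~ x) t (F t x *m Y t x)],
      [/\ jcontmx Z, bounded_mx Z, (forall x, Z 0 x = 1%:M) &
      forall t x, 0 <= t <= T -> mder `[0, T] (Z^~ x) t (- (Z t x *m F t x))] &
      forall t x, 0 <= t <= T -> Z t x *m Y t x = 1%:M /\ Y t x *m Z t x = 1%:M].
Proof.
move=> cF bF.
have c0 : jcontmx (fun _ (_ : P) => 0 : 'M[R]_n) by exact: jcontmx_cst.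
have b0 : @bounded_mx P n n (fun _ (_ : P) => 0 : 'M[R]_n).
  by exists 0 => t x i j; rewrite mxE normr0.
have [Y [cY bY Y0 _ dY]] := linear_ode 1%:M cF c0 bF b0.
(* The inverse solves [Z' = - Z F], with the coefficient on the right. Its transpose solves an
   equation with the coefficient on the left, as [linear_ode] expects. *)
have cF' : jcontmx (fun t x => - (F t x)^T) by apply/jcontmxN/jcontmx_tr.
have bF' : bounded_mx (fun t x => - (F t x)^T).
  by have [C bC] := bF; exists C => t x i j; rewrite !mxE normrN.
have [Z [cZ bZ Z0 _ dZ]] := linear_ode 1%:M cF' c0 bF' b0.
have dY' t x : 0 <= t <= T -> mder `[0, T] (Y^~ x) t (F t x *m Y t x).
  by move=> tT; have := dY t x tT; rewrite addr0.
have dZ' t x : 0 <= t <= T ->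
    mder `[0, T] (fun t => (Z t x)^T) t (- ((Z t x)^T *m F t x)).
  move=> tT; have := mder_tr (dZ t x tT).
  by rewrite addr0 mulNmx linearN /= trmx_mul trmxK.
exists Y, (fun t x => (Z t x)^T); split; first by split.
  split=> //; first exact: jcontmx_tr.
    by have [C bC] := bZ; exists C => t x i j; rewrite mxE.
  by move=> x; rewrite Z0 trmx1.
move=> t x; have Z0' : (Z 0 x)^T = 1%:M by rewrite Z0 trmx1.
exact: (@linear_ode_inverse n F Y (fun t x => (Z t x)^T) t x (Y0 x) Z0'
  (dY' ^~ x) (dZ' ^~ x)).
Qed.

(* The fundamental matrix makes Gronwall's inequality unnecessary: its inverse
   turns the difference of two solutions into a constant. *)
Lemma linear_ode_uniq (n q : nat) (F : R -> P -> 'M[R]_n) (G : R -> 'M[R]_(n, q))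
    (Y Y' : R -> 'M[R]_(n, q)) x t :
  jcontmx F -> bounded_mx F -> Y 0 = Y' 0 ->
  (forall t, 0 <= t <= T -> mder `[0, T] Y t (F t x *m Y t + G t)) ->
  (forall t, 0 <= t <= T -> mder `[0, T] Y' t (F t x *m Y' t + G t)) ->
  0 <= t <= T -> Y t = Y' t.
Proof.
move=> cF bF YY dY dY' tT.
have [M [N [[_ _ M0 dM] [_ _ N0 dN] NM]]] := fundamental_matrix cF bF.
apply/eqP; rewrite -subr_eq0; apply/eqP.
have H : N t x *m (Y t - Y' t) = 0.
  have := @mder0_cst R n q T (fun t => N t x *m (Y t - Y' t)) t.
  rewrite YY subrr mulmx0; apply => // s sT.
  have := mderM (dN s x sT) (mderB (dY s sT) (dY' s sT)).
  rewrite (_ : _ + _ = 0)// mulNmx opprD addrACA subrr addr0 -mulmxBr mulmxA.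
  by rewrite addrC subrr.
have [_ MN] := NM t x tT.
by rewrite -[LHS]mul1mx -MN -mulmxA H mulmx0.
Qed.

End LinearOde.

(** * Differentiability in the parameter *)

Section ParameterDerivative.
Variable R : realType.

(** The argument [u] is the pair (base point, increment); at increment 0 the quotient is completed
    by the derivative [fx]. *)
Definition incr_ratio (f fx : R -> R -> R) (t : R) (u : R * R) : R :=
  if u.2 == 0 then fx t u.1 else (f t (u.1 + u.2) - f t u.1) / u.2.

(** The mean value theorem, for increments of either sign. It gives both the bound on the quotient
    and its continuity at increment 0. *)
Lemma incr_ratio_mvt f fx t u : (forall x, isder setT (f t) x (fx t x)) ->
  exists2 c, `|c - u.1| <= `|u.2| & incr_ratio f fx t u = fx t c.
Proof.
case: u => x h df; rewrite /incr_ratio /=; have [->|h0] := eqVneq h 0.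
  by exists x => //; rewrite subrr.
have [hp|hn] := ltP 0 h.
  have [|c /andP[xc cx] ->] := MVT_isder (a := x) (b := x + h) _ df.
    by rewrite lerDl ltW.
  exists c; last by rewrite addrAC subrr add0r mulfK.
  by rewrite ger0_norm ?subr_ge0// gtr0_norm// lerBlDl.
have {}hn : h < 0 by rewrite lt_neqAle h0.
have [|c /andP[xc cx] fE] := MVT_isder (a := x + h) (b := x) _ df.
  by rewrite gerDl ltW.
exists c; last by rewrite -[_ - _]opprB fE opprD addrA subrr add0r mulrN opprK mulfK.
by rewrite ler0_norm ?subr_le0// ltr0_norm// lerNr opprK lerBrDl.
Qed.

Lemma jcont_incr_ratio f fx : jcont f -> jcont fx ->
  (forall t x, isder setT (f t) x (fx t x)) -> jcont (incr_ratio f fx).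
Proof.
move=> cf cfx df [t0 [x0 h0]].
have [h00|h00] := eqVneq h0 0; last first.
  have c1 : continuous (fun u : R * (R * R) => u.2.1).
    by move=> u; apply: continuous_comp; [exact: cvg_snd|exact: cvg_fst].
  have c2 : continuous (fun u : R * (R * R) => u.2.2).
    by move=> u; apply: continuous_comp; [exact: cvg_snd|exact: cvg_snd].
  have cf1 : continuous (fun u : R * (R * R) => f u.1 (u.2.1 + u.2.2)).
    apply: (jcont_comp cf) => u; first exact: cvg_fst.
    by apply: cvgD; [exact: c1|exact: c2].
  have cf2 : continuous (fun u : R * (R * R) => f u.1 u.2.1).
    by apply: (jcont_comp cf) => // u; exact: cvg_fst.
  rewrite /continuous_at /= {2}/incr_ratio /= (negPf h00).
  apply: (@cvg_trans _ ((fun u : R * (R * R) =>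
      (f u.1 (u.2.1 + u.2.2) - f u.1 u.2.1) / u.2.2) @ (t0, (x0, h0)))).
    apply: near_eq_cvg.
    have h0n : \forall h \near h0, h != 0.
      apply/nbhs_ballP; exists `|h0|; rewrite /= ?normr_gt0// => h.
      by rewrite -ball_normE /=; apply: contraTneq => ->; rewrite subr0 ltxx.
    have := c2 (t0, (x0, h0)) _ h0n.
    apply: (@filterS _ (nbhs (t0, (x0, h0)))) => u /= /negPf u0.
    by rewrite /incr_ratio u0.
  pose u0 := (t0, (x0, h0)).
  exact: (cvgM (cvgB (cf1 u0) (cf2 u0)) (cvgV h00 (c2 u0))).
rewrite h00; apply/cvgrPdist_le => e e0.
have [[A B] /= [nA nB] AB] : \forall u \near (t0, x0), `|fx t0 x0 - fx u.1 u.2| <= e.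
  by have := cfx (t0, x0); move/cvgrPdist_le; exact.
have /nbhs_ballP[d /= d0 dB] := nB.
(* One half is for the displacement of the base point, the other for the distance from the base
   point to the mean value point. *)
have d20 : 0 < d / 2 by rewrite divr_gt0.
exists (A, ball (x0, 0 : R) (d / 2)) => /=.
  by split=> //; exact: nbhsx_ballx.
move=> [t [x h]] /= [At [/= + +]]; rewrite -!ball_normE /= sub0r normrN => xd hd.
rewrite {1}/incr_ratio eqxx.
have [c cx ->] := incr_ratio_mvt (x, h) (df t).
apply: (AB (t, c)); split=> //; apply: dB; rewrite -ball_normE /=.
rewrite (_ : x0 - c = (x0 - x) - (c - x)); last by ring.
rewrite (le_lt_trans (ler_normB _ _))// [d]splitr ltrD//.
exact: le_lt_trans cx hd.
Qed.

Definition c01 (p q : nat) (F Fx : R -> R -> 'M[R]_(p, q)) : Prop :=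
  [/\ jcontmx F, jcontmx Fx, bounded_mx F, bounded_mx Fx &
      forall t x, mder setT (F t) x (Fx t x)].

Definition incr_ratio_mx (p q : nat) (F Fx : R -> R -> 'M[R]_(p, q)) t u :
    'M[R]_(p, q) :=
  \matrix_(i, j) incr_ratio (fun t x => F t x i j) (fun t x => Fx t x i j) t u.

Lemma jcontmx_incr_ratio (p q : nat) (F Fx : R -> R -> 'M[R]_(p, q)) :
  c01 F Fx -> jcontmx (incr_ratio_mx F Fx).
Proof.
move=> [cF cFx _ _ dF] i j; rewrite (_ : (fun _ _ => _) =
    incr_ratio (fun t x => F t x i j) (fun t x => Fx t x i j)).
  by apply: jcont_incr_ratio => // t x; exact: dF.
by apply/funext => t; apply/funext => u; rewrite mxE.
Qed.

Lemma bounded_incr_ratio (p q : nat) (F Fx : R -> R -> 'M[R]_(p, q)) :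
  c01 F Fx -> bounded_mx (incr_ratio_mx F Fx).
Proof.
move=> [_ _ _ [C bFx] dF]; exists C => t u i j; rewrite mxE.
have [|c _ ->] := @incr_ratio_mvt (fun t x => F t x i j)
  (fun t x => Fx t x i j) t u; last exact: bFx.
by move=> x; exact: dF.
Qed.

Lemma incr_ratio_mxE (p q : nat) (F Fx : R -> R -> 'M[R]_(p, q)) t x h :
  h != 0 -> incr_ratio_mx F Fx t (x, h) = h^-1 *: (F t (x + h) - F t x).
Proof.
move=> h0; apply/matrixP => i j; rewrite !mxE /incr_ratio /= (negPf h0).
by rewrite mulrC.
Qed.

Lemma bounded_mxM (P : Type) (p q r : nat) (A : R -> P -> 'M[R]_(p, q))
    (B : R -> P -> 'M[R]_(q, r)) :
  bounded_mx A -> bounded_mx B -> bounded_mx (fun t x => A t x *m B t x).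
Proof.
move=> [C bA] [K bB]; exists (q%:R * (C * K)) => t x i j.
by apply: mulmx_bound => *; [exact: bA|exact: bB].
Qed.

Lemma bounded_mxD (P : Type) (p q : nat) (A B : R -> P -> 'M[R]_(p, q)) :
  bounded_mx A -> bounded_mx B -> bounded_mx (fun t x => A t x + B t x).
Proof.
move=> [C bA] [K bB]; exists (C + K) => t x i j.
by rewrite mxE (le_trans (ler_normD _ _))// lerD.
Qed.

Lemma jcontmx_comp (P Q : topologicalType) (p q : nat) (F : R -> P -> 'M[R]_(p, q))
  (k : Q -> P) : jcontmx F -> continuous k -> jcontmx (fun t x => F t (k x)).
Proof.
move=> cF ck i j; apply: (jcont_comp (cF i j)); first by move=> u; exact: cvg_fst.
by move=> u; apply: continuous_comp; [exact: cvg_snd|exact: ck].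
Qed.

Theorem linear_ode_c01 (T : R) (n q : nat) (F Fx : R -> R -> 'M[R]_n)
    (G Gx : R -> R -> 'M[R]_(n, q)) (M0 : 'M[R]_(n, q)) : 0 < T ->
  c01 F Fx -> c01 G Gx ->
  exists Y Yx : R -> R -> 'M[R]_(n, q),
  [/\ c01 Y Yx, forall x, Y 0 x = M0 &
      forall t x, 0 <= t <= T ->
        mder `[0, T] (Y^~ x) t (F t x *m Y t x + G t x)].
Proof.
move=> T0 FFx GGx.
have [cF cFx bF bFx dF] := FFx; have [cG cGx bG bGx dG] := GGx.
have [Y [cY bY Y0 Yc dY]] := linear_ode T0 M0 cF cG bF bG.
(* [F(x+h) Y(x+h) - F(x) Y(x) = F(x+h) (Y(x+h) - Y(x)) + (F(x+h) - F(x)) Y(x)]: after division by h,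
   the first term contains the unknown quotient, with coefficient [F1], and the second, where [Y] is
   already known, joins the forcing [G1]. *)
pose F1 t (u : R * R) := F t (u.1 + u.2).
pose G1 t (u : R * R) := incr_ratio_mx F Fx t u *m Y t u.1 + incr_ratio_mx G Gx t u.
have cfst : continuous (@fst R R) by move=> u; exact: cvg_fst.
have cF1 : jcontmx F1.
  apply: (jcontmx_comp (k := fun u => u.1 + u.2) cF) => u.
  by apply: cvgD; [exact: cvg_fst|exact: cvg_snd].
have bF1 : bounded_mx F1 by have [C bC] := bF; exists C => t u; exact: bC.
have cG1 : jcontmx G1.
  apply: jcontmxD; last exact: jcontmx_incr_ratio.
  by apply: jcontmxM; [exact: jcontmx_incr_ratio|exact: (jcontmx_comp cY)].
have bG1 : bounded_mx G1.
  apply: bounded_mxD; last exact: bounded_incr_ratio.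
  apply: bounded_mxM; first exact: bounded_incr_ratio.
  by have [C bC] := bY; exists C => t u; exact: bC.
have [Q [cQ bQ Q0 Qc dQ]] := linear_ode T0 0 cF1 cG1 bF1 bG1.
(* [Q] is the difference quotient of [Y] in x, extended to increment 0. *)
have QE t x h : h != 0 -> Q t (x, h) = h^-1 *: (Y t (x + h) - Y t x).
  move=> h0; rewrite -Qc -(Yc t (x + h)) -(Yc t x).
  have := clamp_itv t (ltW T0); move: (clamp T t) => s.
  apply: (@linear_ode_uniq R T T0 _ n q F1 (fun s => G1 s (x, h)) (fun s => Q s (x, h))
    (fun s => h^-1 *: (Y s (x + h) - Y s x)) (x, h)) => //.
  - by rewrite Q0 !Y0 subrr scaler0.
  - by move=> r rT; exact: dQ.
  - move=> r rT; rewrite /G1 /F1 /= !incr_ratio_mxE// addrA.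
    have := mderB (dY r (x + h) rT) (dY r x rT) => H i j.
    rewrite (_ : (fun s => _) = fun s => h^-1 * (Y s (x + h) - Y s x) i j); last first.
      by apply/funext => v; rewrite mxE.
    have -> : (F r (x + h) *m (h^-1 *: (Y r (x + h) - Y r x)) +
      (h^-1 *: (F r (x + h) - F r x)) *m Y r x + h^-1 *: (G r (x + h) - G r x)) =
      h^-1 *: (F r (x + h) *m Y r (x + h) + G r (x + h) -
               (F r x *m Y r x + G r x)).
      rewrite -scalemxAr -scalemxAl -!scalerDr; congr (_ *: _).
      rewrite mulmxBr mulmxBl [in RHS]opprD.
      rewrite [in RHS]addrACA !addrA; congr (_ + _ - _).
      by rewrite subrK.
    by rewrite mxE; apply: isderZ; exact: H.
exists Y, (fun t x => Q t (x, 0)); split=> //; split=> //.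
- apply: (jcontmx_comp (k := fun x : R => (x, 0 : R)) cQ) => x.
  exact: (cvg_pair cvg_id (cvg_cst _)).
- by have [C bC] := bQ; exists C => t x; exact: bC.
- move=> t x i j.
  (* For [s != x] the difference quotient at s is [Q t (x, s - x)], so the derivative is read off
     from the continuity of [Q] at increment 0. *)
  have cH : continuous (fun s => Q t (x, s - x) i j).
    apply: (jcont_comp (cQ i j)); first exact: cst_continuous.
    by move=> s; exact: (cvg_pair (cvg_cst _) (cvgB cvg_id (cvg_cst _))).
  have H : Q t (x, s - x) i j @[s --> x] --> Q t (x, 0) i j.
    by rewrite -(subrr x); exact: cH.
  have {}H : Q t (x, s - x) i j @[s --> within setT x^'] --> Q t (x, 0) i j.
    apply: cvg_trans H; apply: cvg_app => A.
    by rewrite /within /=; apply: (@filterS _ (nbhs x) _) => s; exact.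
  apply: cvg_trans H; apply: near_eq_cvg.
  rewrite /within /=; apply: (@nearW _ (nbhs x) _) => s sx _.
  by rewrite QE ?subr_eq0// mxE mxBE /diff_quot [x + _]addrC subrK mulrC.
Qed.

End ParameterDerivative.

(** * Periodic extension *)

Section Periodic.
Variables (R : realType) (L : R).
Hypothesis L0 : 0 < L.

Definition wrap (x : R) : R := x - (Num.floor (x / L))%:~R * L.

Lemma wrap_itv x : 0 <= wrap x < L.
Proof.
have := floor_itv (x / L); rewrite intrD /wrap; move: (Num.floor _)%:~R => k.
rewrite ler_pdivlMr// ltr_pdivrMr// => /andP[fl fr].
by apply/andP; split; lra.
Qed.

Lemma wrapDz x (k : int) : wrap (x + k%:~R * L) = wrap x.
Proof.
rewrite /wrap mulrDl mulfK ?gt_eqF// floorDrz// intrKfloor intrD; ring.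
Qed.

Lemma wrap_period x : wrap (x + L) = wrap x.
Proof. by rewrite -[X in x + X]mul1r (wrapDz x 1). Qed.

Lemma wrap_add x s : wrap (wrap x + s) = wrap (x + s).
Proof. by rewrite {2}/wrap addrAC -mulNr -intrN wrapDz. Qed.

(** On a closed period only the right endpoint has another representative. A function with equal
    values at 0 and [L] may thus be evaluated on any closed period containing the point. *)
Lemma wrapE x (k : int) : 0 <= x - k%:~R * L <= L ->
  wrap x = x - k%:~R * L \/ (wrap x = 0 /\ x - k%:~R * L = L).
Proof.
move=> /andP[x0 xL]; have [xL'|xL'] := ltP (x - k%:~R * L) L.
  left; rewrite /wrap (@floor_def _ _ k)//.
  rewrite intrD ler_pdivlMr// ltr_pdivrMr// mulrDl mul1r.
  by rewrite -subr_ge0 x0 addrC -ltrBlDr.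
have {xL xL'}xE : x - k%:~R * L = L by apply/eqP; rewrite eq_le xL.
right; split=> //; rewrite /wrap (@floor_def _ _ (k + 1)).
  by rewrite intrD mulrDl mul1r opprD addrA xE subrr.
have -> : x = (k + 1)%:~R * L by rewrite -[LHS](subrK (k%:~R * L)) xE addrC intrD mulrDl mul1r.
by rewrite mulfK ?gt_eqF// lexx ltr_int ltrDl.
Qed.

Definition per (V : Type) (f : R -> V) (x : R) : V := f (wrap x).

Lemma perE (V : Type) (f : R -> V) x (k : int) :
  f 0 = f L -> 0 <= x - k%:~R * L <= L -> per f x = f (x - k%:~R * L).
Proof.
by rewrite /per => f0 /wrapE[->//|[-> ->]].
Qed.

(** Gluing principle: near [u0] the values of [h] stay in the period of [h u0] and the preceding
    one. A local property can therefore be checked on closed periods separately, and only on those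
    containing [h u0]; there are two of them at a multiple of [L]. *)
Lemma near_periods (X : topologicalType) (h : X -> R) (u0 : X) (P : X -> Prop) :
  {for u0, continuous h} ->
  (forall k : int, 0 <= h u0 - k%:~R * L <= L ->
     \forall u \near u0, 0 <= h u - k%:~R * L <= L -> P u) ->
  \forall u \near u0, P u.
Proof.
move=> ch H.
have Hall (k : int) : \forall u \near u0, 0 <= h u - k%:~R * L <= L -> P u.
  have [/H//|] := boolP (0 <= h u0 - k%:~R * L <= L).
  rewrite negb_and -!ltNge => /orP[hk|hk].
    have : \forall u \near u0, h u < k%:~R * L.
      by move: ch => /cvgr_lt; apply; rewrite -subr_lt0.
    apply: filterS => u uk /andP[]; rewrite subr_ge0 => /(lt_le_trans uk).
    by rewrite ltxx.
  have : \forall u \near u0, k%:~R * L + L < h u.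
    by move: ch => /cvgr_gt; apply; rewrite addrC -ltrBrDr.
  apply: filterS => u uk /andP[_]; rewrite lerBlDl => /(lt_le_trans uk).
  by rewrite ltxx.
pose k := Num.floor (h u0 / L).
have /andP[] := wrap_itv (h u0); rewrite /wrap -/k => k0 kL.
have n1 : \forall u \near u0, (k - 1)%:~R * L < h u.
  move: ch => /cvgr_gt; apply; rewrite intrB mulrBl mul1r.
  by lra.
have n2 : \forall u \near u0, h u < k%:~R * L + L.
  by move: ch => /cvgr_lt; apply; rewrite addrC -ltrBlDr.
have /= nk1 := Hall (k - 1); have nk := Hall k.
near=> u.
have u1 : (k - 1)%:~R * L < h u by near: u.
have u2 : h u < k%:~R * L + L by near: u.
move: u1; rewrite intrB mulrBl mul1r => u1.
have [uk|uk] := leP (k%:~R * L) (h u).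
  by apply: (near nk u) => //; rewrite subr_ge0 uk /= lerBlDl ltW.
apply: (near nk1 u) => //; rewrite intrB mulrBl mul1r.
by apply/andP; split; lra.
Unshelve. all: by end_near. Qed.

Lemma isder_nearP (D : set R) f t l : isder D f t l <->
  forall e, 0 < e -> \forall s \near t, D s ->
    `|f s - f t - l * (s - t)| <= e * `|s - t|.
Proof.
split=> [/isderP H e /H[d d0 {}H]|H].
  apply/nbhs_ballP; exists d => //= s; rewrite -ball_normE /= distrC => ? ?.
  exact: H.
apply/isderP => e /H/nbhs_ballP[d /= d0 {}H]; exists d => // s Ds sd.
by apply: H => //; rewrite -ball_normE /= distrC.
Qed.

Lemma isder_per f f' x : f 0 = f L -> f' 0 = f' L ->
  (forall x, 0 <= x <= L -> isder `[0, L] f x (f' x)) ->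
  isder setT (per f) x (per f' x).
Proof.
move=> f0 f'0 df; apply/isder_nearP => e e0.
apply: (@near_periods R id) => [|k xk]; first exact: cvg_id.
have /isderP/(_ e e0)[d d0 H] := df _ xk.
apply/nbhs_ballP; exists d => //= s; rewrite -ball_normE /= distrC => sd sk _.
rewrite (perE f0 xk) (perE f0 sk) (perE f'0 xk).
have := H (s - k%:~R * L); rewrite /= in_itv /= => /(_ sk).
by rewrite opprB addrA subrK => /(_ sd).
Qed.

Variable T : R.
Hypothesis T0 : 0 < T.

(** Frozen in time outside [[0, T]] and periodic in space. The values at 0 and [L] should agree,
    since only [[0, L)] is read. *)
Definition ext (V : Type) (f : R -> R -> V) (t x : R) : V :=
  per (f (clamp T t)) x.

Lemma extE (V : Type) (f : R -> R -> V) t x (k : int) :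
  0 <= t <= T -> f t 0 = f t L -> 0 <= x - k%:~R * L <= L ->
  ext f t x = f t (x - k%:~R * L).
Proof. by move=> tT f0 xk; rewrite /ext clamp_id// (perE _ xk). Qed.

Lemma ext_id (V : Type) (f : R -> R -> V) t x :
  0 <= t <= T -> f t 0 = f t L -> 0 <= x <= L -> ext f t x = f t x.
Proof. by move=> tT f0 xL; rewrite (@extE _ _ _ _ 0)// mul0r subr0. Qed.

Lemma jcont_ext (f : R -> R -> R) :
  {within rect T L, continuous (fun u : R * R => f u.1 u.2)} ->
  (forall t, 0 <= t <= T -> f t 0 = f t L) -> jcont (ext f).
Proof.
move=> /subspace_continuousP cf f0 [t0 x0]; apply/cvgrPdist_le => e e0.
apply: (@near_periods (R * R)%type snd (t0, x0)) => [|k xk]; first exact: cvg_snd.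
have cT t := clamp_itv t (ltW T0).
have rc : rect T L (clamp T t0, x0 - k%:~R * L).
  by split; rewrite /= in_itv /=.
have /cvgrPdist_le/(_ e e0) := cf _ rc.
pose k' (u : R * R) : R * R := (clamp T u.1, u.2 - k%:~R * L).
have ck : k' u @[u --> (t0, x0)] --> (clamp T t0, x0 - k%:~R * L).
  have c1 : {for (t0, x0), continuous (fun u : R * R => clamp T u.1)}.
    by apply: continuous_comp; [exact: cvg_fst|exact: clamp_continuous].
  exact: (cvg_pair c1 (cvgB cvg_snd (cvg_cst _))).
rewrite /within /= => /ck; rewrite /nbhs /=.
apply: (@filterS _ (nbhs (t0, x0))) => -[t x] /= H xk'.
rewrite /ext (perE _ xk) ?f0// (perE _ xk') ?f0//.
by apply: H; split; rewrite /= in_itv /=.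
Qed.

End Periodic.

(** * Functions of class C^1 on a strip *)

Section C1Strip.
Variables (R : realType) (T : R).
Hypothesis T0 : 0 < T.
Implicit Types g h : R -> R -> R.

(* [c1s]: C^1 in both variables on [0, T] * R. The weaker [c01] above asks for no
   derivative in t but for uniform bounds, as needed for coefficients of ODEs. *)
Definition c1s g gt gx : Prop :=
  [/\ jcont g, jcont gt, jcont gx,
      forall t x, 0 <= t <= T -> isder `[0, T] (g^~ x) t (gt t x)
    & forall t x, isder setT (g t) x (gx t x)].

Definition c1 g : Prop := exists gt gx, c1s g gt gx.

Lemma c1_cst c : c1 (fun _ _ => c).
Proof.
exists (fun _ _ => 0), (fun _ _ => 0).
by split=> *; [exact: jcont_cst|exact: jcont_cst|exact: jcont_cst|exact: isder_cst|exact: isder_cst].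
Qed.

Lemma c1D g h : c1 g -> c1 h -> c1 (fun t x => g t x + h t x).
Proof.
move=> [gt [gx [cg cgt cgx dgt dgx]]] [ht [hx [ch cht chx dht dhx]]].
exists (fun t x => gt t x + ht t x), (fun t x => gx t x + hx t x); split.
- exact: jcontD.
- exact: jcontD.
- exact: jcontD.
- by move=> t x tT; apply: isderD; [exact: dgt|exact: dht].
- by move=> t x; exact: isderD.
Qed.

Lemma c1M g h : c1 g -> c1 h -> c1 (fun t x => g t x * h t x).
Proof.
move=> [gt [gx [cg cgt cgx dgt dgx]]] [ht [hx [ch cht chx dht dhx]]].
exists (fun t x => gt t x * h t x + g t x * ht t x),
       (fun t x => gx t x * h t x + g t x * hx t x); split.
- exact: jcontM.
- by apply: jcontD; exact: jcontM.
- by apply: jcontD; exact: jcontM.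
- move=> t x tT; apply: (@isderM R _ (g^~ x) (h^~ x)); [exact: dgt|exact: dht].
- by move=> t x; exact: isderM.
Qed.

Lemma c1_sum (I : Type) (r : seq I) (Q : pred I) (g : I -> R -> R -> R) :
  (forall i, c1 (g i)) -> c1 (fun t x => \sum_(i <- r | Q i) g i t x).
Proof.
move=> cg; elim: r => [|i r IH].
  rewrite (_ : (fun _ _ => _) = fun=> fun=> 0); first exact: c1_cst.
  by apply/funext => t; apply/funext => p; rewrite big_nil.
rewrite (_ : (fun _ _ => _) = fun t p => if Q i
    then g i t p + \sum_(j <- r | Q j) g j t p else \sum_(j <- r | Q j) g j t p).
  by case: (Q i) => //; exact: c1D.
by apply/funext => t; apply/funext => p; rewrite big_cons.
Qed.

Lemma c1_prod (I : Type) (r : seq I) (Q : pred I) (g : I -> R -> R -> R) :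
  (forall i, c1 (g i)) -> c1 (fun t x => \prod_(i <- r | Q i) g i t x).
Proof.
move=> cg; elim: r => [|i r IH].
  rewrite (_ : (fun _ _ => _) = fun=> fun=> 1); first exact: c1_cst.
  by apply/funext => t; apply/funext => p; rewrite big_nil.
rewrite (_ : (fun _ _ => _) = fun t p => if Q i
    then g i t p * \prod_(j <- r | Q j) g j t p else \prod_(j <- r | Q j) g j t p).
  by case: (Q i) => //; exact: c1M.
by apply/funext => t; apply/funext => p; rewrite big_cons.
Qed.

Lemma isderV (D : set R) (f : R -> R) t l : (forall s, f s != 0) -> isder D f t l ->
  isder D (fun s => (f s)^-1) t (- l * ((f t)^-1 * (f t)^-1)).
Proof.
move=> f0 df.
have cf : f s @[s --> within D t^'] --> f t.
  apply: cvg_trans (isder_cvg df); apply: cvg_app => A.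
  by rewrite /within /=; apply: (@filterS _ (nbhs t) _) => s H _; exact: H.
rewrite /isder (_ : diff_quot _ t =
    fun s => - diff_quot f t s * ((f s)^-1 * (f t)^-1)).
  exact: (cvgM (cvgN df) (cvgM (cvgV (f0 t) cf) (cvg_cst _))).
apply/funext => s; rewrite /diff_quot; move: (s - t)^-1 => d.
by field; rewrite !f0.
Qed.

Lemma jcontV (P : topologicalType) (g : R -> P -> R) : (forall t x, g t x != 0) -> jcont g ->
  jcont (fun t x => (g t x)^-1).
Proof. by move=> g0 cg u; exact: (cvgV (g0 _ _) (cg u)). Qed.

Lemma c1V g : (forall t x, g t x != 0) -> c1 g -> c1 (fun t x => (g t x)^-1).
Proof.
move=> g0 [gt [gx [cg cgt cgx dgt dgx]]].
have cV := jcontV g0 cg.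
exists (fun t x => - gt t x * ((g t x)^-1 * (g t x)^-1)),
  (fun t x => - gx t x * ((g t x)^-1 * (g t x)^-1)); split=> //.
- by apply: jcontM; [exact: jcontN|exact: jcontM].
- by apply: jcontM; [exact: jcontN|exact: jcontM].
- move=> t x tT; apply: (@isderV _ (g^~ x)) => //; exact: dgt.
- by move=> t x; exact: isderV.
Qed.

Lemma c1s_snd (f f' : R -> R) : (forall x, isder setT f x (f' x)) ->
  continuous f' -> c1s (fun _ => f) (fun _ _ => 0) (fun _ => f').
Proof.
move=> df cf'; split.
- apply: jcont_snd => x; have := isder_cvg (df x); apply: cvg_trans; apply: cvg_app => A.
  by rewrite /within /=; apply: (@filterS _ (nbhs x) _) => s; exact.
- exact: jcont_cst.
- exact: jcont_snd.
- by move=> *; exact: isder_cst.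
- by move=> t x; exact: df.
Qed.

Lemma incr_ratioE (f fx : R -> R -> R) t x k :
  f t (x + k) - f t x = k * incr_ratio f fx t (x, k).
Proof.
rewrite /incr_ratio /=; have [->|k0] := eqVneq k 0.
  by rewrite addr0 subrr mul0r.
by rewrite mulrC divfK.
Qed.

Lemma isder_quot (D : set R) f k t l : (forall r, r != t -> diff_quot f t r = k r) ->
  k r @[r --> within D t^'] --> l -> isder D f t l.
Proof.
move=> fk; apply: cvg_trans; apply: near_eq_cvg.
by rewrite /within /=; apply: (@nearW _ (nbhs t) _) => r rt _; rewrite fk.
Qed.

(** Chain rule in the direction [(1, s)]. The increment is split into a change of time at the fixed
    position [x + s * t] and a change of position at the new time r; the second part is
    [s * (r - t)] times [incr_ratio], whose joint continuity permits the moving time. *)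
Lemma isder_diag g gx (D : set R) s t x l : jcont g -> jcont gx ->
  (forall t x, isder setT (g t) x (gx t x)) ->
  isder D (g^~ (x + s * t)) t l ->
  isder D (fun r => g r (x + s * r)) t (l + s * gx t (x + s * t)).
Proof.
move=> cg cgx dgx dgt.
have cQ := jcont_incr_ratio cg cgx dgx.
have ck : (fun r => incr_ratio g gx r (x + s * t, s * (r - t))) @ t -->
    incr_ratio g gx t (x + s * t, s * (t - t)).
  apply: (jcont_comp (f := id) (k := fun r => (x + s * t, s * (r - t))) cQ).
    by move=> r; exact: cvg_id.
  move=> r; exact: (cvg_pair (cvg_cst _) (cvgM (cvg_cst s) (cvgB cvg_id (cvg_cst t)))).
have {}ck : (fun r => incr_ratio g gx r (x + s * t, s * (r - t))) @ within D t^' -->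
    gx t (x + s * t).
  move: ck; rewrite subrr mulr0 {2}/incr_ratio eqxx /=; apply: cvg_trans.
  apply: cvg_app => A.
  by rewrite /within /=; apply: (@filterS _ (nbhs t) _) => r H _ _.
apply: (isder_quot (k := fun r => diff_quot (g^~ (x + s * t)) t r +
    s * incr_ratio g gx r (x + s * t, s * (r - t)))) => [r rt|]; last first.
  exact: (cvgD dgt (cvgM (cvg_cst s) ck)).
have rt0 : r - t != 0 by rewrite subr_eq0.
have -> : diff_quot (fun r => g r (x + s * r)) t r =
    diff_quot (g^~ (x + s * t)) t r +
    (g r (x + s * t + s * (r - t)) - g r (x + s * t)) / (r - t).
  rewrite /diff_quot (_ : x + s * t + s * (r - t) = x + s * r); last by ring.
  by field.
by rewrite (incr_ratioE g gx); field.
Qed.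

(** Speed [s = 1] passes to coordinates (time, starting point of the characteristic), and [s = -1]
    goes back. *)
Lemma c1s_shear g gt gx s : c1s g gt gx ->
  c1s (fun t x => g t (x + s * clamp T t))
      (fun t x => gt t (x + s * clamp T t) + s * gx t (x + s * clamp T t))
      (fun t x => gx t (x + s * clamp T t)).
Proof.
move=> [cg cgt cgx dgt dgx].
have csh (f : R -> R -> R) : jcont f -> jcont (fun t x => f t (x + s * clamp T t)).
  move=> cf; apply: (jcont_comp (f := fun u : R * R => u.1)
     (k := fun u : R * R => u.2 + s * clamp T u.1) cf) => u; first exact: cvg_fst.
  have cc : {for u, continuous (fun u : R * R => clamp T u.1)}.
    by apply: continuous_comp; [exact: cvg_fst|exact: clamp_continuous].
  exact: (cvgD cvg_snd (cvgM (cvg_cst s) cc)).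
split.
- exact: csh.
- by apply: jcontD; [exact: csh|apply: jcontM; [exact: jcont_cst|exact: csh]].
- exact: csh.
- move=> t x tT; rewrite clamp_id//.
  apply: (@isder_eq _ _ (fun r => g r (x + s * r))).
  + by rewrite /= in_itv.
  + by move=> r; rewrite /= in_itv /= => rT; rewrite clamp_id.
  + by apply: isder_diag => //; exact: dgt.
- by move=> t x; apply: isder_shift; exact: dgx.
Qed.

Section Matrices.

Definition c1mx (p q : nat) (F : R -> R -> 'M[R]_(p, q)) : Prop :=
  forall i j, c1 (fun t x => F t x i j).

Lemma c1mxD p q (F G : R -> R -> 'M[R]_(p, q)) :
  c1mx F -> c1mx G -> c1mx (fun t x => F t x + G t x).
Proof.
move=> cF cG i j; rewrite (_ : (fun _ _ => _) = fun t x => F t x i j + G t x i j).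
  exact: c1D.
by apply/funext => t; apply/funext => x; rewrite mxE.
Qed.

Lemma c1mxN p q (F : R -> R -> 'M[R]_(p, q)) : c1mx F -> c1mx (fun t x => - F t x).
Proof.
move=> cF i j; rewrite (_ : (fun _ _ => _) = fun t x => -1 * F t x i j).
  by apply: c1M => //; exact: c1_cst.
by apply/funext => t; apply/funext => x; rewrite mxE mulN1r.
Qed.

Lemma c1mxM p q r (F : R -> R -> 'M[R]_(p, q)) (G : R -> R -> 'M[R]_(q, r)) :
  c1mx F -> c1mx G -> c1mx (fun t x => F t x *m G t x).
Proof.
move=> cF cG i j.
rewrite (_ : (fun _ _ => _) = fun t x => \sum_k F t x i k * G t x k j).
  by apply: c1_sum => k; exact: c1M.
by apply/funext => t; apply/funext => x; rewrite mxE.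
Qed.

Lemma c1mxZ p q (g : R -> R -> R) (F : R -> R -> 'M[R]_(p, q)) :
  c1 g -> c1mx F -> c1mx (fun t x => g t x *: F t x).
Proof.
move=> cg cF i j; rewrite (_ : (fun _ _ => _) = fun t x => g t x * F t x i j).
  exact: c1M.
by apply/funext => t; apply/funext => x; rewrite mxE.
Qed.

Lemma c1mx_tr p q (F : R -> R -> 'M[R]_(p, q)) :
  c1mx F -> c1mx (fun t x => (F t x)^T).
Proof.
move=> cF i j; rewrite (_ : (fun _ _ => _) = fun t x => F t x j i)//.
by apply/funext => t; apply/funext => x; rewrite mxE.
Qed.

Lemma c1_det p (F : R -> R -> 'M[R]_p) : c1mx F -> c1 (fun t x => \det (F t x)).
Proof.
move=> cF; rewrite /determinant; apply: c1_sum => s; apply: c1M; first exact: c1_cst.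
by apply: c1_prod => i; exact: cF.
Qed.

(** By the cofactor formula, each entry is a determinant times the reciprocal of a determinant. The
    reciprocal asks for invertibility on the whole plane. *)
Lemma c1mx_inv p (F : R -> R -> 'M[R]_p) : (forall t x, F t x \in unitmx) ->
  c1mx F -> c1mx (fun t x => invmx (F t x)).
Proof.
move=> uF cF i j.
rewrite (_ : (fun _ _ => _) = fun t x => (\det (F t x))^-1 *
    ((-1) ^+ (j + i) * \det (row' j (col' i (F t x))))); last first.
  by apply/funext => t; apply/funext => x; rewrite /invmx uF !mxE.
apply: c1M.
  apply: c1V; last exact: c1_det.
  by move=> t x; have := uF t x; rewrite unitmxE unitfE.
apply: c1M; first exact: c1_cst.
apply: c1_det => k l.
rewrite (_ : (fun _ _ => _) = fun t x => F t x (lift j k) (lift i l))//.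
by apply/funext => t; apply/funext => x; rewrite !mxE.
Qed.

Lemma c1mx_shear p q (F : R -> R -> 'M[R]_(p, q)) s : c1mx F ->
  c1mx (fun t x => F t (x + s * clamp T t)).
Proof.
move=> cF i j; have [gt [gx]] := cF i j; move=> /(c1s_shear s) H.
by eexists; eexists; exact: H.
Qed.

Lemma c1mx_shift p q (F : R -> R -> 'M[R]_(p, q)) c : c1mx F ->
  c1mx (fun t x => F t (x + c)).
Proof.
move=> cF i j; have [gt [gx [cg cgt cgx dgt dgx]]] := cF i j.
have csh (f : R -> R -> R) : jcont f -> jcont (fun t x => f t (x + c)).
  move=> cf; apply: (jcont_comp (f := fun u : R * R => u.1)
    (k := fun u : R * R => u.2 + c) cf) => u; first exact: cvg_fst.
  exact: (cvgD cvg_snd (cvg_cst c)).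
exists (fun t x => gt t (x + c)), (fun t x => gx t (x + c)).
split; [exact: (csh _ cg)|exact: (csh _ cgt)|exact: (csh _ cgx)| |].
- by move=> t x; exact: dgt.
- by move=> t x; apply: (@isder_shift _ (fun y => F t y i j)); exact: dgx.
Qed.

(** At a frozen time only the derivative in x matters. This serves the final values of the
    propagator and of the Gramian. *)
Lemma c01_c1mx_at p q (F Fx : R -> R -> 'M[R]_(p, q)) t : c01 F Fx ->
  c1mx (fun _ => F t).
Proof.
move=> [_ cFx _ _ dF] i j; do 2 eexists; apply: (@c1s_snd _ (fun x => Fx t x i j)).
  by move=> x; exact: dF.
apply: (@jcont_comp _ _ _ _ (fun=> t) id (cFx i j)); first exact: cst_continuous.
by move=> x; exact: cvg_id.
Qed.

Lemma c01_c1mx p q (F Ft Fx : R -> R -> 'M[R]_(p, q)) : c01 F Fx -> jcontmx Ft ->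
  (forall t x, 0 <= t <= T -> mder `[0, T] (F^~ x) t (Ft t x)) -> c1mx F.
Proof.
move=> [cF cFx _ _ dF] cFt dFt i j.
exists (fun t x => Ft t x i j), (fun t x => Fx t x i j); split=> //.
  by move=> t x tT; exact: dFt.
by move=> t x; exact: dF.
Qed.

End Matrices.
End C1Strip.

(** * From the rectangle to the strip and back *)

Section Bridge.
Variable R : realType.

Lemma within_continuous_eq (X Y : topologicalType) (D : set X) (f g : X -> Y) :
  (forall u, D u -> f u = g u) -> {within D, continuous f} ->
  {within D, continuous g}.
Proof.
move=> fg /subspace_continuousP cf; apply/subspace_continuousP => u Du.
move: (cf u Du); rewrite /from_subspace -(fg u Du) => H; apply: cvg_trans H; apply: near_eq_cvg.
by rewrite /within /=; apply: (@nearW _ (nbhs u) _) => v Dv; rewrite fg.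
Qed.

Lemma isder_derivable (D : set R) f t l : isder D f t l -> derivable_in D f t.
Proof. by move=> H; apply/cvg_ex; exists l. Qed.

Lemma derivable_isder (D : set R) f t :
  derivable_in D f t -> isder D f t (derive_in D f t).
Proof. exact. Qed.

Lemma derive_inE (T : R) f t l : 0 < T -> 0 <= t <= T -> isder `[0, T] f t l ->
  derive_in `[0, T] f t = l.
Proof.
move=> T0 tT H.
exact: (isder_seg_uniq T0 tT (derivable_isder (isder_derivable H)) H).
Qed.

Lemma mder_derivable (p q : nat) (T : R) (F : R -> 'M[R]_(p, q)) t l :
  mder `[0, T] F t l -> derivable_mx_in `[0, T] F t.
Proof. by move=> H i j; exact: isder_derivable (H i j). Qed.

Lemma derivable_mder (p q : nat) (D : set R) (F : R -> 'M[R]_(p, q)) t :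
  derivable_mx_in D F t -> mder D F t (derive_mx_in D F t).
Proof. by move=> H i j; rewrite mxE; exact: (H i j). Qed.

Lemma derive_mxE (p q : nat) (T : R) (F : R -> 'M[R]_(p, q)) t l :
  0 < T -> 0 <= t <= T -> mder `[0, T] F t l -> derive_mx_in `[0, T] F t = l.
Proof.
move=> T0 tT H; apply/matrixP => i j; rewrite mxE.
by apply: derive_inE => //; exact: H.
Qed.

Section Rectangles.
Variables (T L : R).
Hypotheses (T0 : 0 < T) (L0 : 0 < L).

Lemma rect_itv (u : R * R) : rect T L u -> 0 <= u.1 <= T /\ 0 <= u.2 <= L.
Proof. by case: u => t x [/=]; rewrite !in_itv /=. Qed.

Lemma C1per_rect_c1s (p q : nat) (F : R -> R -> 'M[R]_(p, q)) i j :
  C1per_rect T L F ->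
  c1s T (fun t x => ext L T F t x i j) (fun t x => ext L T (d_t T F) t x i j)
    (fun t x => ext L T (d_x L F) t x i j).
Proof.
move=> [[cF dF cFt cFx] perF].
have F0 t : 0 <= t <= T -> F t 0 = F t L.
  by move=> tT; apply: (perF t _).1; rewrite in_itv.
have Fx0 t : 0 <= t <= T -> d_x L F t 0 = d_x L F t L.
  by move=> tT; apply: (perF t _).2; rewrite in_itv.
(* Periodicity of the time derivative follows from that of [F]: the same function of t is
   differentiated on both sides. *)
have Ft0 t : 0 <= t <= T -> d_t T F t 0 = d_t T F t L.
  move=> tT; apply: derive_mxE => //.
  have [||dFt _] := dF t L; rewrite ?in_itv//= ?lexx ?ltW//.
  apply: mder_eq (derivable_mder dFt); first by rewrite /= in_itv.
  by move=> s; rewrite /= in_itv /= => sT; rewrite F0.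
split.
- by apply: (@jcont_ext _ L L0 T T0 (fun t x => F t x i j)); [exact: cF|move=> t /F0 ->].
- by apply: (@jcont_ext _ L L0 T T0 (fun t x => d_t T F t x i j)); [exact: cFt|move=> t /Ft0 ->].
- by apply: (@jcont_ext _ L L0 T T0 (fun t x => d_x L F t x i j)); [exact: cFx|move=> t /Fx0 ->].
- move=> t x tT; rewrite /ext clamp_id// /per.
  have /andP[w0 wL] := wrap_itv L0 x.
  have [||dFt _] := dF t (wrap L x); rewrite ?in_itv//= ?w0 ?ltW//.
  apply: (@isder_eq _ _ (fun s => F s (wrap L x) i j)).
  + by rewrite /= in_itv.
  + by move=> s; rewrite /= in_itv /= => sT; rewrite clamp_id.
  + exact: (@derivable_mder p q _ (F^~ (wrap L x)) t dFt i j).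
- move=> t x; have cT := clamp_itv t (ltW T0); rewrite /ext.
  apply: (@isder_per _ L L0 (fun x => F (clamp T t) x i j)
     (fun x => d_x L F (clamp T t) x i j)).
  + by rewrite (F0 _ cT).
  + by rewrite (Fx0 _ cT).
  + move=> y yL; have [||_ dFx] := dF (clamp T t) y; rewrite ?in_itv//=.
    exact: (@derivable_mder p q _ (F (clamp T t)) y dFx i j).
Qed.

Lemma C1per_rect_c1mx (p q : nat) (F : R -> R -> 'M[R]_(p, q)) :
  C1per_rect T L F -> c1mx T (ext L T F).
Proof. by move=> H i j; do 2 eexists; exact: C1per_rect_c1s. Qed.

Lemma c1mx_C1per_rect (p q : nat) (F : R -> R -> 'M[R]_(p, q)) :
  c1mx T F -> (forall t x, 0 <= t <= T -> F t (x + L) = F t x) ->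
  C1per_rect T L F.
Proof.
move=> cF pF.
have dtE i j gt gx t x : c1s T (fun t x => F t x i j) gt gx ->
    0 <= t <= T -> d_t T F t x i j = gt t x.
  move=> [_ _ _ dgt _] tT; rewrite mxE; apply: derive_inE => //; exact: dgt.
have dxE i j gt gx t x : c1s T (fun t x => F t x i j) gt gx ->
    0 <= x <= L -> d_x L F t x i j = gx t x.
  move=> [_ _ _ _ dgx] xL; rewrite mxE; apply: derive_inE => //.
  exact: (isder_subset (@subsetT _ _) (dgx t x)).
split; last first.
  move=> t; rewrite in_itv /= => tT; split; first by rewrite -[L in RHS]add0r pF.
  apply/matrixP => i j; have [gt [gx cg]] := cF i j.
  rewrite !(dxE _ _ _ _ _ _ cg) ?lexx ?ltW//.
  have [_ _ _ _ dgx] := cg.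
  have := dgx t L; rewrite -{1}[L]add0r => /isder_shift.
  under [X in isder _ X]eq_fun do rewrite pF//.
  apply: isder_uniq (dgx t 0) => d d0; exists (d / 2); split=> //.
    by rewrite gt_eqF// divr_gt0.
  by rewrite subr0 gtr0_norm ?divr_gt0// ltr_pdivrMr// ltr_pMr// ltr1n.
split.
- move=> i j; have [gt [gx [cg _ _ _ _]]] := cF i j; exact: continuous_subspaceT cg.
- move=> t x; rewrite !in_itv /= => tT xL; split=> i j;
    have [gt [gx [_ _ _ dgt dgx]]] := cF i j.
    by apply: isder_derivable; exact: dgt.
  by apply: isder_derivable; exact: (isder_subset (@subsetT _ _) (dgx t x)).
- move=> i j; have [gt [gx cg]] := cF i j.
  apply: (within_continuous_eq (f := fun u => gt u.1 u.2)).
    by move=> u /rect_itv[? ?]; rewrite (dtE _ _ _ _ _ _ cg).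
  by have [_ cgt _ _ _] := cg; exact: continuous_subspaceT cgt.
- move=> i j; have [gt [gx cg]] := cF i j.
  apply: (within_continuous_eq (f := fun u => gx u.1 u.2)).
    by move=> u /rect_itv[? ?]; rewrite (dxE _ _ _ _ _ _ cg).
  by have [_ _ cgx _ _] := cg; exact: continuous_subspaceT cgx.
Qed.

Lemma c1mx_C1_seg (p q : nat) (F : R -> R -> 'M[R]_(p, q)) x :
  c1mx T F -> C1_seg T (F^~ x).
Proof.
move=> cF; split.
- move=> i j; have [gt [gx [cg _ _ _ _]]] := cF i j.
  exact/continuous_subspaceT/(@jcont_slice _ _ (fun t x => F t x i j)).
- move=> t; rewrite in_itv /= => tT i j; have [gt [gx [_ _ _ dgt _]]] := cF i j.
  by apply: isder_derivable; exact: dgt.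
- move=> i j; have [gt [gx [_ cgt _ dgt _]]] := cF i j.
  apply: (within_continuous_eq (f := gt^~ x)).
    move=> t; rewrite /= in_itv /= => tT; rewrite mxE.
    by rewrite (derive_inE T0 tT (dgt t x tT)).
  exact/continuous_subspaceT/jcont_slice.
Qed.

Lemma c1s_per (f f' : R -> R) : f 0 = f L -> f' 0 = f' L ->
  (forall x, 0 <= x <= L -> isder `[0, L] f x (f' x)) ->
  {within `[0, L], continuous f'} ->
  c1s T (fun _ => per L f) (fun _ _ => 0) (fun _ => per L f').
Proof.
move=> f0 f'0 df /subspace_continuousP cf'.
apply: c1s_snd; first by move=> x; exact: isder_per.
have H : jcont (ext L T (fun _ => f')).
  apply: (@jcont_ext _ L L0 T T0 (fun _ => f')) => //.
  apply/subspace_continuousP => -[t x] [/= _ xL].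
  have := cf' x xL; apply: cvg_trans => A; rewrite /nbhs /= /within /= => H.
  by exists (setT, [set y | `[0, L]%classic y -> A (f' y)]) =>
    [|[s y] [/= _ ys] [_ /ys]]; first by split=> //; exact: filterT.
exact: (@jcont_comp _ _ _ _ (fun=> 0) id H (@cst_continuous _ _ 0) (fun x => cvg_id)).
Qed.

Lemma C1per_seg_c1mx (p q : nat) (F : R -> 'M[R]_(p, q)) :
  C1per_seg L F -> c1mx T (fun _ => per L F).
Proof.
move=> [[cF dF cF'] F0 F'0] i j; do 2 eexists.
apply: (@c1s_per (fun x => F x i j) (fun x => derive_mx_in `[0, L] F x i j)).
- by rewrite F0.
- by rewrite F'0.
- move=> x xL; apply: (@derivable_mder p q _ F x) => //.
  by apply: dF; rewrite in_itv.
- exact: cF'.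
Qed.

End Rectangles.
End Bridge.

(** * Characteristics and active times *)

Section Characteristics.
Variables (R : realType) (T L : R).
Hypotheses (T0 : 0 < T) (L0 : 0 < L).

(** [c - x + k%:R * L] is the time at which the straight line issued from x meets the k-th translate
    of c. *)
Lemma tau_clamp (k : nat) x c : tau T L k x c = clamp T (c - x + k%:R * L).
Proof.
rewrite /tau /clamp; set s := c - x + _.
have [s0|s0] := ltP s 0.
  by rewrite min_l ?max_l ?ltW// (lt_trans s0).
have [sT|sT] := leP s T; first by rewrite max_r// ?min_l.
by rewrite max_r// ltW.
Qed.

Lemma kmin_le x c (k : nat) : (kmin L x c <= k%:Z) = (0 < c - x + k%:R * L).
Proof.
rewrite /kmin lezD1 floor_lt_int ltr_pdivrMr// -subr_gt0.
by congr (_ < _); rewrite -pmulrn; ring.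
Qed.

Lemma kmax_ge x c (k : nat) : (k%:Z <= kmax T L x c) = (c - x + k%:R * L < T).
Proof.
rewrite /kmax lerBrDr lezD1 ceil_gt_int ltr_pdivlMr// -subr_gt0 -[RHS]subr_gt0.
by congr (_ < _); rewrite -pmulrn; ring.
Qed.

Lemma clamp_le (s t : R) : s <= t -> 0 <= t <= T -> clamp T s <= t.
Proof.
by move=> st /andP[t0 tT]; rewrite /clamp ge_max t0 ge_min st.
Qed.

Lemma clamp_ge (s t : R) : t <= s -> 0 <= t <= T -> t <= clamp T s.
Proof.
by move=> ts /andP[t0 tT]; rewrite /clamp le_max le_min ts tT orbT.
Qed.

Lemma clamp_lt (s t : R) : 0 < t -> clamp T s < t -> (s < t) || (T < t).
Proof. by move=> t0; rewrite /clamp gt_max t0 /= gt_min. Qed.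

(** This is the form in which the definition of [Xbar] is used: the straight line brought back by
    whole periods into the closed interval [[0, L]]. *)
Lemma Xbar_spec t x : 0 <= x < L -> 0 <= t <= T ->
  exists k : nat, Xbar T L t x = x + t - k%:R * L /\ 0 <= Xbar T L t x <= L.
Proof.
move=> /andP[x0 xL] /andP[t0 tT]; rewrite /Xbar tau_clamp mul0r addr0.
case: ifPn => [tc|].
  exists 0%N; rewrite mul0r subr0 [t + x]addrC; split=> //.
  rewrite addr_ge0//=; move: tc; rewrite /clamp le_max => /orP[t00|].
    by have -> : t = 0 by [apply/eqP; rewrite eq_le t00]; rewrite addr0 ltW.
  by rewrite le_min => /andP[+ _]; rewrite lerBrDl.
rewrite -ltNge => ct; set P := [set k : nat | _].
have tLx : L - x < t.
  have tp : 0 < t by rewrite (le_lt_trans _ ct)// /clamp le_max lexx.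
  by have /orP[//|] := clamp_lt tp ct; rewrite ltNge tT.
have : P (xget 0%N P).
  (* The index is [k = c - 1], for which [k L < t + x <= (k + 1) L]. The ceiling matches pieces open
     on the left: at a crossing time the characteristic is still at [L]. *)
  apply: xgetPex; pose c := Num.ceil ((t + x) / L).
  have cge : (t + x) <= c%:~R * L by rewrite -ler_pdivrMr// ceil_ge.
  have c11 : 1 <= c - 1.
    by rewrite lerBrDr lezD1 ceil_gt_int ltr_pdivlMr// mul1r; lra.
  have clt : (c - 1)%:~R * L < t + x.
    by rewrite -ltr_pdivlMr// -ceil_gt_int ltrBlDr ltrDl.
  have [k kE] : exists k : nat, c - 1 = k%:Z.
    by exists `|c - 1|%N; rewrite gez0_abs// (le_trans _ c11).
  have kR : (c - 1)%:~R = k%:R :> R by rewrite kE -pmulrn.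
  have cR : c%:~R = k%:R + 1 :> R by rewrite -kR intrB; ring.
  have k1 : 1 <= k%:R :> R by rewrite -kR ler1z.
  move: clt cge; rewrite kR cR => clt cge.
  exists k; rewrite /P /= kmin_le kmax_ge !tau_clamp; split.
    by apply/andP; split; nra.
  apply/andP; split; last by apply: clamp_ge; [lra|rewrite t0].
  by rewrite /clamp gt_max gt_min; apply/andP; split; [lra|apply/orP; left; lra].
move: (xget _ _) => k; rewrite /P /= kmin_le kmax_ge !tau_clamp.
move=> [/andP[k1 k2] /andP[k3 k4]].
have kp : (0 < k)%N by rewrite lt0n; apply: contraTneq k1 => ->; rewrite mul0r -leNgt; lra.
(* The exit through [L] from the preceding period is the entry at 0 into this one. *)
have kE : L - x + k.-1%:R * L = 0 - x + k%:R * L.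
  by rewrite -[in RHS](prednK kp) -natr1; ring.
rewrite kE clamp_id; last by rewrite !ltW.
exists k; split; first by ring.
move: k3; rewrite clamp_id; last by rewrite !ltW.
move=> k3; move: k4; rewrite /clamp le_max leNgt (lt_trans k1 k3)/= le_min => /andP[k4 _].
by apply/andP; split; lra.
Qed.

(** At a crossing time [Xbar] is [L] whereas the extension reads [f] at 0; equal boundary values
    reconcile the two. *)
Lemma ext_Xbar (V : Type) (f : R -> R -> V) t x :
  (forall t, 0 <= t <= T -> f t 0 = f t L) -> 0 <= x < L -> 0 <= t <= T ->
  ext L T f t (x + t) = f t (Xbar T L t x).
Proof.
move=> f0 xL tT; have [k [XE XL]] := Xbar_spec xL tT.
rewrite XE (@extE _ L L0 T _ f t (x + t) k%:Z) -?pmulrn// ?f0//.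
by rewrite -XE.
Qed.

Lemma continuous_neq0 (g : R -> R) c : continuous g -> g c != 0 ->
  exists2 d, 0 < d & forall x, `|x - c| < d -> g x != 0.
Proof.
move=> cg gc; have := cg c; move=> /cvgrPdist_lt /(_ `|g c|).
rewrite normr_gt0 => /(_ gc)/nbhs_ballP[d /= d0 H]; exists d => // x xc.
have := H x; rewrite -ball_normE /= distrC => /(_ xc).
by apply: contraTneq => ->; rewrite subr0 ltxx.
Qed.

(** * Supported controls vanish outside the active times *)

Section Support.
Variables (m : nat) (a b : R) (Theta : R -> R -> 'cV[R]_m).
Hypotheses (ha : 0 <= a) (hab : a < b) (hb : b <= L).
Hypothesis cTheta : C1per_rect T L Theta.
Hypothesis suppTheta : control_support T L Theta `<=` `[0, T] `*` `[a, b].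

Let supp t x : 0 <= t <= T -> 0 <= x <= L -> Theta t x <> 0 -> a <= x <= b.
Proof.
move=> tT xL Th; have : control_support T L Theta (t, x).
  by apply: subset_closure; split=> //; split; rewrite /= in_itv /=.
by move=> /suppTheta[_ /=]; rewrite in_itv.
Qed.

Let near_nonzero t c : 0 <= t <= T -> 0 <= c <= L -> Theta t c <> 0 ->
  exists2 d, 0 < d & forall x, 0 <= x <= L -> `|x - c| < d -> Theta t x <> 0.
Proof.
move=> tT cL Th.
have Th0 : Theta t 0 = Theta t L.
  by have [_ /(_ t)] := cTheta; rewrite in_itv => /(_ tT)[].
have [i Thi] : exists i, Theta t c i 0 != 0.
  apply/existsP; apply: contra_notT Th; rewrite negb_exists => /forallP H.
  by apply/colP => i; rewrite mxE; apply/eqP; move: (H i); rewrite negbK.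
have [ce _ _ _ _] := C1per_rect_c1s T0 L0 i (0 : 'I_1) cTheta.
have cg : continuous (fun x => ext L T Theta t x i 0).
  apply: (@jcont_comp _ _ _ _ (fun=> t) id ce); first exact: cst_continuous.
  by move=> x; exact: cvg_id.
have [|d d0 H] := continuous_neq0 cg (c := c).
  by rewrite (ext_id L0 tT Th0 cL).
exists d => // x xL /H; rewrite (ext_id L0 tT Th0 xL) => /eqP H0 H1.
by apply: H0; rewrite H1 mxE.
Qed.

(** The index k of the period in which the line lies in [[a, b]] is the natural one, but [kmin] and
    [kmax] impose strict inequalities. They fail only if the line is at b at time 0 or at a at time
    [T]. Then [Theta] would, by continuity, be nonzero slightly beyond b or slightly before a,
    against the support condition, unless [a = 0]. *)
Lemma active_support t x : 0 <= x < L -> 0 <= t <= T ->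
  Theta t (Xbar T L t x) <> 0 -> active_times T L a b x t.
Proof.
move=> xL tT; have [k [-> XL]] := Xbar_spec xL tT => Th.
have Th0 : Theta t 0 = Theta t L.
  by have [_ /(_ t)] := cTheta; rewrite in_itv => /(_ tT)[].
have /andP[aX Xb] := supp tT XL Th; set X := x + t - _ in Th XL aX Xb.
have mem (j : nat) : a - x + j%:R * L <= t <= b - x + j%:R * L ->
    0 < b - x + j%:R * L -> a - x + j%:R * L < T -> active_times T L a b x t.
  move=> /andP[j1 j2] j3 j4; exists j; rewrite /= ?kmin_le ?kmax_ge ?j3//.
  by rewrite in_itv /= !tau_clamp clamp_le// clamp_ge.
have /andP[t0 tT'] := tT; have /andP[x0 xL'] := xL.
have h1 : a - x + k%:R * L <= t <= b - x + k%:R * L.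
  by apply/andP; split; rewrite /X in aX Xb; lra.
have /andP[h1a h1b] := h1.
have [h2|h2] := ltP 0 (b - x + k%:R * L); last first.
  have tE : t = 0 by lra.
  have XE : X = b by rewrite /X; lra.
  have k0 : 0 <= k%:R * L by rewrite mulr_ge0// ltW.
  have bL : b < L by lra.
  have [d d0 H] := near_nonzero tT XL Th.
  pose e := Num.min (d / 2) (L - b).
  have e0 : 0 < e by rewrite lt_min divr_gt0// subr_gt0.
  have ed : e <= d / 2 by rewrite /e ge_min lexx.
  have eb : e <= L - b by rewrite /e ge_min lexx orbT.
  have XeL : 0 <= X + e <= L by apply/andP; split; lra.
  have /(supp tT XeL) : Theta t (X + e) <> 0.
    by apply: H => //; rewrite addrAC subrr add0r gtr0_norm//; lra.
  by move=> /andP[_]; lra.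
have [h3|h3] := ltP (a - x + k%:R * L) T; first exact: (mem k).
have tE : t = T by lra.
have XE : X = a by rewrite /X; lra.
have [ap|a0] := ltP 0 a.
  have [d d0 H] := near_nonzero tT XL Th.
  pose e := Num.min (d / 2) a.
  have e0 : 0 < e by rewrite lt_min divr_gt0.
  have ed : e <= d / 2 by rewrite /e ge_min lexx.
  have ea : e <= a by rewrite /e ge_min lexx orbT.
  have XeL : 0 <= X - e <= L by apply/andP; split; lra.
  have /(supp tT XeL) : Theta t (X - e) <> 0.
    by apply: H => //; rewrite addrAC subrr add0r normrN gtr0_norm//; lra.
  by move=> /andP[+ _]; lra.
(* The line re-enters at [a = 0] exactly at time [T]. By periodicity [Theta] is nonzero at [L] too,
   so [L <= b], and this passage through [L] belongs to the index [k.-1]. *)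
have aE : a = 0 by lra.
have LL : 0 <= L <= L by rewrite lexx ltW.
have /(supp tT LL)/andP[_ Lb] : Theta t L <> 0 by rewrite -Th0 -aE -XE.
have {}XE : x + t - k%:R * L = 0 by rewrite -aE -XE.
have [k0|kp] := posnP k.
  by move: XE; rewrite k0 mul0r; move: T0; lra.
have kE : k%:R * L = k.-1%:R * L + L :> R by rewrite -[in LHS](prednK kp) -natr1; ring.
move: T0 L0 => T0' L0'; rewrite kE in h1a h1b h2 h3 XE.
by apply: (mem k.-1); [apply/andP; split; lra|lra|lra].
Qed.

End Support.

(** Since the bounds on k are strict, the interval of passage through [[a, b]], cut to [[0, T]],
    runs from [Num.max 0 u] to a strictly larger [Num.min T v]. Each of its points is thus a limit
    of interior ones, where the line is strictly between a and b. *)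
Lemma active_closure (a b x t d : R) : a < b -> 0 <= x < L -> 0 <= t <= T ->
  active_times T L a b x t -> 0 < d ->
  exists s, [/\ 0 <= s <= T, `|s - t| < d &
    exists k : nat, a < x + s - k%:R * L < b].
Proof.
move=> ab xL tT [k /=]; rewrite kmin_le kmax_ge => /andP[v0 uT].
rewrite in_itv /= !tau_clamp; set u := a - x + _ in uT *; set v := b - x + _ in v0 *.
move=> /andP[ut tv] d0.
have uv : u < v by rewrite /u /v; lra.
pose c := Num.max 0 u; pose e := Num.min T v.
have ce : c < e by rewrite lt_min !gt_max T0 v0 uT uv.
have ct : c <= t.
  move: ut; rewrite /clamp (min_l (ltW uT)) -/c //.
have te : t <= e.
  by move: tv; rewrite /clamp max_r 1?minC// le_min !ltW.
have c0 : 0 <= c by rewrite /c le_max lexx.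
have cu : u <= c by rewrite /c le_max lexx orbT.
have eT : e <= T by rewrite /e ge_min lexx.
have ev : e <= v by rewrite /e ge_min lexx orbT.
have [s [cs se st]] : exists s, [/\ c < s, s < e & `|s - t| < d].
  have [te'|te'] := ltP t e.
    pose r := Num.min (d / 2) ((e - t) / 2).
    have r0 : 0 < r by rewrite lt_min !divr_gt0// subr_gt0.
    have r1 : r <= d / 2 by rewrite /r ge_min lexx.
    have r2 : r <= (e - t) / 2 by rewrite /r ge_min lexx orbT.
    exists (t + r); split; [lra|lra|].
    by rewrite addrAC subrr add0r gtr0_norm//; lra.
  pose r := Num.min (d / 2) ((e - c) / 2).
  have r0 : 0 < r by rewrite lt_min !divr_gt0// subr_gt0.
  have r1 : r <= d / 2 by rewrite /r ge_min lexx.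
  have r2 : r <= (e - c) / 2 by rewrite /r ge_min lexx orbT.
  exists (t - r); split; [lra|lra|].
  by rewrite addrAC subrr add0r normrN gtr0_norm//; lra.
exists s; split=> //; first by apply/andP; split; lra.
exists k; rewrite /u in cu; rewrite /v in ev.
by apply/andP; split; lra.
Qed.

(** * A periodic C^1 weight supported in [a, b] *)

Section Bump.
Variables (a b : R).
Hypotheses (ha : 0 <= a) (hab : a < b) (hb : b <= L).

(** Squaring the positive part of the quadratic with roots a and b makes it C^1 across the roots. *)
Definition bump (x : R) : R := Num.max 0 ((x - a) * (b - x)) ^+ 2.

(** The remainder lies between 0 and [(v - u) ^+ 2], so the radius can be e itself. *)
Lemma isder_max0_sqr u : isder setT (fun u : R => Num.max 0 u ^+ 2) u (2 * Num.max 0 u).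
Proof.
apply/isderP => e e0; exists e => // v _ ve.
apply: (@le_trans _ _ (`|v - u| * `|v - u|)); last by rewrite ler_wpM2r// ltW.
rewrite -normrM ger0_norm -?expr2 ?sqr_ge0// ler_norml.
have := sqr_ge0 (v - u); rewrite !expr2 => H.
by have [v0|v0] := leP 0 v; have [u0|u0] := leP 0 u; apply/andP; split; nra.
Qed.

Definition dbump (x : R) : R :=
  2 * Num.max 0 ((x - a) * (b - x)) * (a + b - 2 * x).

Lemma bump_per_c1s : c1s T (fun _ => per L bump) (fun _ _ => 0) (fun _ => per L dbump).
Proof.
move: ha hab hb => ha' hab' hb'; pose q (x : R) := (x - a) * (b - x).
have q0 : q 0 <= 0 by rewrite /q sub0r subr0 mulNr oppr_le0 mulr_ge0//; lra.
have qL : q L <= 0 by rewrite /q mulr_ge0_le0//; lra.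
apply: (@c1s_per R T L T0 L0 bump dbump).
- by rewrite /bump -!/(q _) !max_l.
- by rewrite /dbump -!/(q _) !max_l// mulr0 !mul0r.
- move=> x _; apply: (isder_subset (@subsetT _ _)).
  apply: derive_isder; apply: (@is_derive1_comp R (fun u => Num.max 0 u ^+ 2) q).
    apply: (@isder_derive _ setT); last exact: isder_max0_sqr.
    exact: (@filterT _ (nbhs (q x))).
  apply: (@isder_derive _ setT); first exact: (@filterT _ (nbhs x)).
  have -> : a + b - 2 * x = (1 - 0) * (b - x) + (x - a) * (0 - 1) by ring.
  apply: isderM; apply: isderB; by [exact: isder_id|exact: isder_cst].
- apply: continuous_subspaceT => x; rewrite /dbump.
  have cq : {for x, continuous q}.
    exact: (cvgM (cvgB cvg_id (cvg_cst a)) (cvgB (cvg_cst b) cvg_id)).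
  have cm : {for x, continuous (fun x => Num.max 0 (q x))}.
    by apply: (@continuous_max _ _ (fun=> 0) q) => //; exact: cst_continuous.
  have c2 : {for x, continuous (fun x => 2 * Num.max 0 (q x))}.
    exact: (cvgM (cvg_cst (2 : R)) cm).
  have c3 : {for x, continuous (fun x : R => a + b - 2 * x)}.
    exact: (cvgB (cvg_cst (a + b)) (cvgM (cvg_cst (2 : R)) cvg_id)).
  exact: (cvgM c2 c3).
Qed.

Lemma bump_per_gt0 x (k : nat) : a < x - k%:R * L < b -> 0 < per L bump x.
Proof.
move: ha hab hb => ha' hab' hb'; move=> /andP[ax xb]; rewrite (@perE _ _ L0 _ _ _ k%:Z) -?pmulrn.
- by rewrite exprn_gt0// lt_max; apply/orP; right; rewrite mulr_gt0// subr_gt0.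
- rewrite /bump !max_l//.
    by rewrite mulr_ge0_le0//; lra.
  by rewrite sub0r subr0 mulNr oppr_le0 mulr_ge0//; lra.
- by apply/andP; split; lra.
Qed.

Lemma bump_neq0 x : bump x != 0 -> a <= x <= b.
Proof.
move: ha hab hb => ha' hab' hb'; rewrite /bump; apply: contraNT; rewrite negb_and -!ltNge => H.
rewrite max_l ?expr0n//; move: H => /orP[H|H].
  by rewrite mulr_le0_ge0//; lra.
by rewrite mulr_ge0_le0//; lra.
Qed.

Lemma bump_per x : 0 <= x <= L -> per L bump x = bump x.
Proof.
move: ha hab hb => ha' hab' hb' xL; rewrite (@perE _ _ L0 _ _ _ 0) ?mul0r ?subr0//.
rewrite /bump !max_l//.
  by rewrite mulr_ge0_le0//; lra.
by rewrite sub0r subr0 mulNr oppr_le0 mulr_ge0//; lra.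
Qed.

Lemma bump_per_ge0 x : 0 <= per L bump x.
Proof. exact: sqr_ge0. Qed.

End Bump.
End Characteristics.

(** * Necessity *)

Section Necessity.
Variables (R : realType) (T L : R).
Hypotheses (T0 : 0 < T) (L0 : 0 < L).

Lemma C1per_rect_dt (p q : nat) (F : R -> R -> 'M[R]_(p, q)) t :
  C1per_rect T L F -> 0 <= t <= T -> d_t T F t 0 = d_t T F t L.
Proof.
move=> [[_ dF _ _] perF] tT; apply: derive_mxE => //.
have [||dFt _] := dF t L; rewrite ?in_itv//= ?lexx ?ltW//.
apply: mder_eq (derivable_mder dFt); first by rewrite /= in_itv.
move=> s; rewrite /= in_itv /= => sT.
by have [->] : F s 0 = F s L /\ d_x L F s 0 = d_x L F s L by apply: perF; rewrite in_itv.
Qed.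

Lemma wrapK x : wrap L (wrap L x) = wrap L x.
Proof.
have /andP[w0 wL] := wrap_itv L0 x.
have [|->|[_]] := @wrapE _ L L0 (wrap L x) 0; rewrite mul0r subr0 ?w0 ?ltW//.
by move=> wE; rewrite wE ltxx in wL.
Qed.

Lemma jcont_bounded_per (f : R -> R -> R) : jcont f -> 
  (forall t x, f t x = f (clamp T t) (wrap L x)) -> exists C, forall t x, `|f t x| <= C.
Proof.
move=> cf fE.
have cK : compact (rect T L) by apply: compact_setX; exact: segment_compact.
have := continuous_compact (continuous_subspaceT cf) cK.
move=> /compact_bounded[C [_ bC]].
exists (C + 1) => t x; rewrite fE; apply: (bC (C + 1)); first by rewrite ltrDl.
exists (clamp T t, wrap L x) => //.
have /andP[w0 wL] := wrap_itv L0 x.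
by split; rewrite /= in_itv /= ?w0 ?(ltW wL) ?clamp_itv ?ltW.
Qed.

(** The bounds come from compactness: the extensions take all their values on the closed
    rectangle. *)
Lemma C1per_rect_c01 (p q : nat) (F : R -> R -> 'M[R]_(p, q)) : C1per_rect T L F ->
  c01 (fun t x => ext L T F t (x + 1 * clamp T t))
      (fun t x => ext L T (d_x L F) t (x + 1 * clamp T t)).
Proof.
move=> cF.
have H i j := c1s_shear 1 (C1per_rect_c1s T0 L0 i j cF).
have bnd (G : R -> R -> 'M[R]_(p, q)) : jcontmx (ext L T G) ->
    bounded_mx (fun t x => ext L T G t (x + 1 * clamp T t)).
  move=> cG; have bG i j : exists C, forall t x, `|ext L T G t x i j| <= C.
    apply: (@jcont_bounded_per (fun t x => ext L T G t x i j)) => // t x.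
    rewrite /ext clampK ?ltW// /per; congr (G _ _ i j).
    by rewrite wrapK.
  have [C hC] := choice (fun ij : 'I_p * 'I_q => bG ij.1 ij.2).
  exists (\sum_ij `|C ij|) => t x i j; apply: (le_trans (hC (i, j) t _)).
  rewrite (bigD1 (i, j)) //= (le_trans (ler_norm _))// lerDl.
  exact: sumr_ge0.
split.
- by move=> i j; have [] := H i j.
- by move=> i j; have [] := H i j.
- by apply: bnd => i j; have [] := C1per_rect_c1s T0 L0 i j cF.
- by apply: bnd => i j; have [] := C1per_rect_c1s T0 L0 i j cF.
- by move=> t x i j; have [_ _ _ _] := H i j; apply.
Qed.

Lemma c01N (p q : nat) (F Fx : R -> R -> 'M[R]_(p, q)) :
  c01 F Fx -> c01 (fun t x => - F t x) (fun t x => - Fx t x).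
Proof.
move=> [cF cFx [C bF] [C' bFx] dF]; split.
- exact: jcontmxN.
- exact: jcontmxN.
- by exists C => t x i j; rewrite mxE normrN.
- by exists C' => t x i j; rewrite mxE normrN.
- by move=> t x; apply: mderN; exact: dF.
Qed.

Lemma C1per_seg_cst (p q : nat) (M : 'M[R]_(p, q)) : C1per_seg L (fun=> M).
Proof.
have dM x : 0 <= x <= L -> derive_mx_in `[0, L] (fun=> M) x = 0.
  by move=> xL; apply: derive_mxE => //; exact: mder_cst.
split=> //; last by rewrite !dM ?lexx ?ltW.
split.
- by move=> i j; apply: continuous_subspaceT; exact: cst_continuous.
- by move=> x _; apply: (@mder_derivable _ _ _ _ _ _ 0); exact: mder_cst.
- move=> i j; apply: (within_continuous_eq (f := fun=> 0)).
    by move=> x; rewrite /= in_itv /= => /dM ->; rewrite mxE.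
  by apply: continuous_subspaceT; exact: cst_continuous.
Qed.

Variables (n m : nat) (a b : R) (A : R -> R -> 'M[R]_n) (B : R -> R -> 'M[R]_(n, m)).
Hypotheses (hA : C1per_rect T L A) (hB : C1per_rect T L B).

Lemma C1per_rect_per (p q : nat) (F : R -> R -> 'M[R]_(p, q)) t :
  C1per_rect T L F -> 0 <= t <= T -> F t 0 = F t L.
Proof. by move=> [_ pF] tT; apply: (pF t _).1; rewrite in_itv. Qed.

Lemma exactly_controllable_ode x :
  0 <= a -> a < b -> b <= L ->
  exactly_controllable T L a b A B -> 0 <= x < L ->
  ode_controllable T (fun t => - A t (Xbar T L t x))
    (fun t => B t (Xbar T L t x)) (ode_controls T L a b x).
Proof.
move=> ha hab hb H xL z0 z1.
have [Th [cTh sTh [y [cy [pde yL y0] yT]]]] :=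
  H _ _ (C1per_seg_cst z0) (C1per_seg_cst z1).
have extX (V : Type) (F : R -> R -> V) t : (forall t, 0 <= t <= T -> F t 0 = F t L) ->
    0 <= t <= T -> ext L T F t (x + 1 * clamp T t) = F t (Xbar T L t x).
  by move=> F0 tT; rewrite clamp_id// mul1r (ext_Xbar T0 L0).
have ThX t (tT : 0 <= t <= T) := extX _ Th t (fun t => C1per_rect_per cTh) tT.
have yX t (tT : 0 <= t <= T) := extX _ y t (fun t => C1per_rect_per cy) tT.
(* On the straight line the extended control is visibly C^1; on [[0, T]] it has the values of [Th]
   along [Xbar], which vanish outside the active times. *)
exists (fun t => ext L T Th t (x + 1 * clamp T t)).
  split; first exact: (c1mx_C1_seg T0 x (c1mx_shear 1 (C1per_rect_c1mx T0 L0 cTh))).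
  move=> t [/= ]; rewrite in_itv /= => tT nt; apply: contrapT; rewrite ThX// => Tt.
  by apply: nt; apply: active_support Tt.
exists (fun t => ext L T y t (x + 1 * clamp T t)); split.
- move=> t; rewrite in_itv /= => tT.
  have [k [_ XL]] := Xbar_spec T0 L0 xL tT.
  have dz : mder `[0, T] (fun t => ext L T y t (x + 1 * clamp T t)) t
     (d_t T y t (Xbar T L t x) + d_x L y t (Xbar T L t x)).
    have <- : ext L T (d_t T y) t (x + 1 * clamp T t) = d_t T y t (Xbar T L t x).
      by apply: extX => // s sT; exact: C1per_rect_dt cy sT.
    have <- : ext L T (d_x L y) t (x + 1 * clamp T t) = d_x L y t (Xbar T L t x).
      by apply: extX => // s sT; have [_ py] := cy; apply: (py s _).2; rewrite in_itv.
    move=> i j; have [_ _ _ + _] := c1s_shear 1 (C1per_rect_c1s T0 L0 i j cy).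
    by move=> /(_ t x tT) dd; rewrite mxE; move: dd; rewrite !mul1r.
  split; first exact: mder_derivable dz.
  rewrite (derive_mxE T0 tT dz) yX// ThX// mulNmx.
  have := pde t (Xbar T L t x); rewrite !in_itv /= => /(_ tT XL) <-.
  by rewrite [RHS]addrC addrK.
- rewrite yX ?lexx ?ltW//.
  have -> : Xbar T L 0 x = x.
    rewrite /Xbar tau_clamp// mul0r addr0 add0r /clamp le_max lexx //.
  by rewrite y0// in_itv /=; case/andP: xL => -> /ltW ->.
- have TT : 0 <= T <= T by rewrite lexx ltW.
  rewrite yX// yT// in_itv /=.
  by have [k [_ XL]] := Xbar_spec T0 L0 xL TT.
Qed.

Lemma ode_controllable_time : (0 < n)%N -> 0 <= a -> a < b -> b <= L ->
  (forall x : R, 0 <= x < L ->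
     ode_controllable T (fun t => - A t (Xbar T L t x))
       (fun t => B t (Xbar T L t x)) (ode_controls T L a b x)) ->
  T > L - (b - a).
Proof.
move=> n0 ha hab hb H; rewrite ltNge; apply/negP => TL.
(* From b, the line is just leaving at time 0, which the strict bound [kmin] excludes, and next
   meets a at time [L - (b - a)]. If [b = L], the line from 0 first meets a at time
   [a = L - (b - a)]. Either time is at least [T]. *)
pose x := if b < L then b else 0.
have xL : 0 <= x < L.
  by rewrite /x; case: ifPn => bL; rewrite ?lexx ?L0 ?bL ?andbT//; move: hab ha; lra.
have noact t : ~ active_times T L a b x t.
  move=> [k /=]; rewrite kmin_le// kmax_ge// => /andP[k1 k2] _.
  move: T0 L0 => T0' L0'.
  move: k1 k2; rewrite /x; case: ifPn => [bL|]; last rewrite -leNgt => Lb.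
    case: k => [|k]; first by rewrite mul0r addr0 subrr ltxx.
    have : 0 <= k%:R * L by rewrite mulr_ge0// ltW.
    by rewrite -natr1 mulrDl mul1r => *; lra.
  have : 0 <= k%:R * L by rewrite mulr_ge0// ltW.
  by move=> *; lra.
(* Without active times the control is 0 and the solution from 0 stays at 0; the target differs from
   0 because n is positive. *)
have [psi [_ psi0] [z [dz z0 zT]]] := H x xL 0 (const_mx 1).
have [cF _ bF _ _] := c01N (C1per_rect_c01 hA).
have TT : 0 <= T <= T by rewrite lexx ltW.
have : z T = 0.
  apply: (linear_ode_uniq T0 (F := fun t x => - ext L T A t (x + 1 * clamp T t))
    (G := fun=> 0) (Y := z) (Y' := fun=> 0) (x := x) cF bF _ _ _ TT).
  - exact: z0.
  - move=> t tT; have tT' : t \in `[0, T] by rewrite in_itv.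
    have [dzt ezt] := dz t tT'.
    have := derivable_mder dzt; rewrite ezt psi0.
      rewrite mulmx0 clamp_id// mul1r (ext_Xbar T0 L0)// => s sT.
      exact: C1per_rect_per.
    by split; [exact: tT'|exact: noact].
  - by move=> t tT; rewrite mulmx0 addr0; exact: mder_cst.
rewrite zT => /matrixP/(_ (Ordinal n0) 0); rewrite !mxE => /eqP.
by rewrite oner_eq0.
Qed.

End Necessity.

(** * Propagators and Gramian *)

Section C01Closure.
Variable R : realType.

Lemma c01_cst (p q : nat) (M : 'M[R]_(p, q)) : c01 (fun _ _ => M) (fun _ _ => 0).
Proof.
split; [exact: jcontmx_cst|exact: jcontmx_cst| | |].
- exists (\sum_i \sum_j `|M i j|) => t x i j.
  rewrite (bigD1 i) //= (bigD1 j) //= -addrA lerDl addr_ge0//.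
    by apply: sumr_ge0.
  by apply: sumr_ge0 => ? _; apply: sumr_ge0.
- by exists 0 => t x i j; rewrite mxE normr0.
- by move=> t x; exact: mder_cst.
Qed.

Lemma c01_tr (p q : nat) (F Fx : R -> R -> 'M[R]_(p, q)) :
  c01 F Fx -> c01 (fun t x => (F t x)^T) (fun t x => (Fx t x)^T).
Proof.
move=> [cF cFx [C bF] [C' bFx] dF]; split.
- exact: jcontmx_tr.
- exact: jcontmx_tr.
- by exists C => t x i j; rewrite mxE.
- by exists C' => t x i j; rewrite mxE.
- by move=> t x; apply: mder_tr; exact: dF.
Qed.

Lemma c01M (p q r : nat) (F Fx : R -> R -> 'M[R]_(p, q)) (G Gx : R -> R -> 'M[R]_(q, r)) :
  c01 F Fx -> c01 G Gx ->
  c01 (fun t x => F t x *m G t x) (fun t x => Fx t x *m G t x + F t x *m Gx t x).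
Proof.
move=> [cF cFx bF bFx dF] [cG cGx bG bGx dG]; split.
- exact: jcontmxM.
- by apply: jcontmxD; exact: jcontmxM.
- exact: bounded_mxM.
- by apply: bounded_mxD; exact: bounded_mxM.
- by move=> t x; apply: mderM; [exact: dF|exact: dG].
Qed.

(** Carrying the scalar as a scalar matrix reduces this to the product rule [c01M]. *)
Lemma c01Z (p q : nat) (g gx : R -> R -> R) (F Fx : R -> R -> 'M[R]_(p, q)) :
  c01 (fun t x => (g t x)%:M : 'M[R]_p) (fun t x => (gx t x)%:M) -> c01 F Fx ->
  exists Gx, c01 (fun t x => g t x *: F t x) Gx.
Proof.
move=> cg cF; have := c01M cg cF.
rewrite (_ : (fun t x => _ *m F t x) = fun t x => g t x *: F t x).
  by move=> H; eexists; exact: H.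
by apply/funext => t; apply/funext => x; rewrite mul_scalar_mx.
Qed.

Lemma c01_scalar (p : nat) (g gx : R -> R -> R) : jcont g -> jcont gx ->
  (exists C, forall t x, `|g t x| <= C) -> (exists C, forall t x, `|gx t x| <= C) ->
  (forall t x, isder setT (g t) x (gx t x)) ->
  c01 (fun t x => (g t x)%:M : 'M[R]_p) (fun t x => (gx t x)%:M).
Proof.
have jcs (f : R -> R -> R) : jcont f -> jcontmx (fun t x => (f t x)%:M : 'M[R]_p).
  move=> cf i j; rewrite (_ : (fun _ _ => _) = fun t x => f t x * (i == j)%:R).
    by apply: jcontM => //; exact: jcont_cst.
  by apply/funext => t; apply/funext => x; rewrite mxE mulr_natr.
have bs (f : R -> R -> R) : (exists C, forall t x, `|f t x| <= C) ->
    bounded_mx (fun t x => (f t x)%:M : 'M[R]_p).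
  move=> [C bC]; exists C => t x i j; rewrite mxE; case: (i == j) => /=.
    by rewrite mulr1n.
  by rewrite mulr0n normr0 (le_trans _ (bC t x)).
move=> cg cgx bg bgx dg; split; [exact: jcs|exact: jcs|exact: bs|exact: bs|].
move=> t x i j; rewrite mxE -mulr_natr.
rewrite (_ : (fun _ => _) = fun x => g t x * (i == j)%:R).
  rewrite -[X in isder _ _ _ X]addr0 -(mulr0 (g t x)).
  by apply: isderM; [exact: dg|exact: isder_cst].
by apply/funext => y; rewrite mxE mulr_natr.
Qed.

Lemma jcontmxZ (P : topologicalType) (p q : nat) (g : R -> P -> R)
    (F : R -> P -> 'M[R]_(p, q)) :
  jcont g -> jcontmx F -> jcontmx (fun t x => g t x *: F t x).
Proof.
move=> cg cF i j; rewrite (_ : (fun _ _ => _) = fun t x => g t x * F t x i j).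
  exact: jcontM.
by apply/funext => t; apply/funext => x; rewrite mxE.
Qed.

End C01Closure.

Section Propagators.
Variables (R : realType) (T L : R).
Hypotheses (T0 : 0 < T) (L0 : 0 < L).
Variables (n m : nat) (a b : R) (A : R -> R -> 'M[R]_n) (B : R -> R -> 'M[R]_(n, m)).
Hypotheses (hA : C1per_rect T L A) (hB : C1per_rect T L B).
Hypotheses (ha : 0 <= a) (hab : a < b) (hb : b <= L).

(** Here x is a starting point: [F] is read at time t on the characteristic issued from x. The
    factor 1 keeps the shape of [c1s_shear]. *)
Definition along (V : Type) (F : R -> R -> V) (t x : R) : V :=
  ext L T F t (x + 1 * clamp T t).

Definition along_bump (t x : R) : R := along (fun _ => bump a b) t x.

Lemma along_wrap (V : Type) (F : R -> R -> V) t x x' :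
  wrap L x = wrap L x' -> along F t x = along F t x'.
Proof.
by move=> xx; rewrite /along /ext /per -(wrap_add L0) xx (wrap_add L0).
Qed.

Lemma along_bump_c1s : c1s T along_bump
  (fun t x => 0 + 1 * per L (dbump a b) (x + 1 * clamp T t))
  (fun t x => per L (dbump a b) (x + 1 * clamp T t)).
Proof. exact: c1s_shear (bump_per_c1s T0 L0 ha hab hb). Qed.

Lemma along_bump_c01 : c01 (fun t x => (along_bump t x)%:M : 'M[R]_n)
  (fun t x => (per L (dbump a b) (x + 1 * clamp T t))%:M).
Proof.
have [cg _ cgx _ dgx] := along_bump_c1s.
have [cb _ cbx _ _] := bump_per_c1s T0 L0 ha hab hb.
have bnd (f : R -> R) : jcont (fun _ : R => per L f) ->
    exists C, forall t x, `|per L f (x + 1 * clamp T t)| <= C.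
  move=> cf; have [|C bC] := jcont_bounded_per T0 L0 cf.
    by move=> t x; rewrite /per wrapK.
  by exists C => t x; exact: bC t _.
by apply: c01_scalar => //; exact: bnd.
Qed.

Lemma propagators : exists M N W : R -> R -> 'M[R]_n,
  [/\ [/\ exists Mx, c01 M Mx, exists Nx, c01 N Nx & exists Wx, c01 W Wx],
      [/\ forall x, M 0 x = 1%:M, forall x, N 0 x = 1%:M & forall x, W 0 x = 0],
      [/\ forall t x, 0 <= t <= T ->
            mder `[0, T] (M^~ x) t (- along A t x *m M t x),
          forall t x, 0 <= t <= T ->
            mder `[0, T] (N^~ x) t (- (N t x *m - along A t x))
        & forall t x, 0 <= t <= T -> mder `[0, T] (W^~ x) t
            (along_bump t x *: ((N t x *m along B t x) *m (N t x *m along B t x)^T))]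
    & forall t x, 0 <= t <= T -> N t x *m M t x = 1%:M /\ M t x *m N t x = 1%:M].
Proof.
have cA := c01N (C1per_rect_c01 T0 L0 hA); have cB := C1per_rect_c01 T0 L0 hB.
have [M [Mx [cM M0 dM]]] := linear_ode_c01 1%:M T0 cA (c01_cst (0 : 'M[R]_n)).
(* [fundamental_matrix] carries no derivative in x, so both propagators are produced by
   [linear_ode_c01], the inverse again through its transpose. *)
have [N [Nx [cN N0 dN]]] := linear_ode_c01 1%:M T0 (c01N (c01_tr cA)) (c01_cst (0 : 'M[R]_n)).
have cNt := c01_tr cN; have cNB := c01M cNt cB.
have [Gx cG] := c01Z along_bump_c01 (c01M cNB (c01_tr cNB)).
(* A primitive in time is a solution with zero linear part, so its derivative in x comes from the
   same theorem. *)
have [W [Wx [cW W0 dW]]] := linear_ode_c01 0 T0 (c01_cst (0 : 'M[R]_n)) cG.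
have dM' t x : 0 <= t <= T -> mder `[0, T] (M^~ x) t (- along A t x *m M t x).
  by move=> tT; have := dM t x tT; rewrite addr0.
have dN' t x : 0 <= t <= T -> mder `[0, T] (fun t => (N t x)^T) t
    (- ((N t x)^T *m - along A t x)).
  move=> tT; have := mder_tr (dN t x tT).
  by rewrite addr0 mulNmx linearN /= trmx_mul trmxK.
have N0' x : (N 0 x)^T = 1%:M by rewrite N0 trmx1.
exists M, (fun t x => (N t x)^T), W; split.
- by split; eexists; [exact: cM|exact: cNt|exact: cW].
- by [].
- split=> // t x tT; have := dW t x tT; rewrite mul0mx add0r.
  exact.
- move=> t x tT.
  exact: (@linear_ode_inverse R T R n (fun t x => - along A t x) M
    (fun t x => (N t x)^T) t x (M0 x) (N0' x) (dM' ^~ x) (dN' ^~ x) tT).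
Qed.

End Propagators.

(** * Sufficiency *)

Section Sufficiency.
Variables (R : realType) (T L : R).
Hypotheses (T0 : 0 < T) (L0 : 0 < L).
Variables (n m : nat) (a b : R) (A : R -> R -> 'M[R]_n) (B : R -> R -> 'M[R]_(n, m)).
Hypotheses (hA : C1per_rect T L A) (hB : C1per_rect T L B).
Hypotheses (ha : 0 <= a) (hab : a < b) (hb : b <= L).

Notation Aa := (along T L A).
Notation Ba := (along T L B).
Notation eta := (along_bump T L a b).

Variables M N W : R -> R -> 'M[R]_n.
Hypotheses (M0 : forall x, M 0 x = 1%:M) (N0 : forall x, N 0 x = 1%:M)
  (W0 : forall x, W 0 x = 0).
Hypothesis dM : forall t x, 0 <= t <= T -> mder `[0, T] (M^~ x) t (- Aa t x *m M t x).
Hypothesis dN : forall t x, 0 <= t <= T -> mder `[0, T] (N^~ x) t (- (N t x *m - Aa t x)).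
Hypothesis dW : forall t x, 0 <= t <= T -> mder `[0, T] (W^~ x) t
            (eta t x *: ((N t x *m Ba t x) *m (N t x *m Ba t x)^T)).
Hypothesis NM : forall t x, 0 <= t <= T -> N t x *m M t x = 1%:M /\ M t x *m N t x = 1%:M.
Variables Mx Nx Wx : R -> R -> 'M[R]_n.
Hypotheses (cM : c01 M Mx) (cN : c01 N Nx) (cW : c01 W Wx).

Let TT : 0 <= T <= T. Proof. by rewrite lexx ltW. Qed.

(** Congruent starting points have the same coefficients, so [(N t x - N t x') M t x] has zero
    derivative and starts at 0. The periodicity of the control and of the trajectory rests on this
    and its analogues for [M] and [W]. *)
Lemma N_wrap t x x' : wrap L x = wrap L x' -> 0 <= t <= T -> N t x = N t x'.
Proof.
move=> xx tT; apply/eqP; rewrite -subr_eq0; apply/eqP.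
have H : (N t x - N t x') *m M t x = 0.
  have := @mder0_cst R n n T (fun t => (N t x - N t x') *m M t x) t.
  rewrite !N0 subrr mul0mx; apply=> // s sT.
  have := mderM (mderB (@dN s x sT) (@dN s x' sT)) (@dM s x sT).
  rewrite (along_wrap T L0 A s xx) (_ : _ + _ = 0)//.
  by rewrite !(mulmxN, mulNmx) !opprK -mulmxBl mulmxA subrr.
have [_ MN] := @NM t x tT.
by rewrite -[LHS]mulmx1 -MN mulmxA H mul0mx.
Qed.

Lemma M_wrap t x x' : wrap L x = wrap L x' -> 0 <= t <= T -> M t x = M t x'.
Proof.
move=> xx tT; have [_ MN] := @NM t x tT; have [NM' _] := @NM t x' tT.
by rewrite -[LHS]mulmx1 -NM' -(N_wrap xx tT) mulmxA MN mul1mx.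
Qed.

Lemma W_wrap t x x' : wrap L x = wrap L x' -> 0 <= t <= T -> W t x = W t x'.
Proof.
move=> xx tT; apply/eqP; rewrite -subr_eq0; apply/eqP.
have := @mder0_cst R n n T (fun t => W t x - W t x') t.
rewrite !W0 subrr; apply=> // s sT.
have := mderB (@dW s x sT) (@dW s x' sT).
by rewrite (along_wrap T L0 B s xx) (N_wrap xx sT) /along_bump (along_wrap T L0 _ s xx) subrr.
Qed.

(** If [v W(T) = 0], then [v W(t) v^T] is nondecreasing and 0 at both ends, hence 0 throughout. Its
    derivative is [eta] times the squared norm of [v N B], so [v N B] vanishes where [eta] is
    positive and, by continuity and [active_closure], at every active time. *)
Lemma gramian_unit x :
  (forall x : R, 0 <= x < L ->
     ode_controllable T (fun t => - A t (Xbar T L t x))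
       (fun t => B t (Xbar T L t x)) (ode_controls T L a b x)) ->
  W T x \in unitmx.
Proof.
(* The hypothesis covers starting points in [[0, L)], while [c1mx_inv] asks for every real x; the
   Gramian depends on x modulo [L] only. *)
move=> H; rewrite (W_wrap (esym (wrapK L0 x)) TT).
have xL := wrap_itv L0 x; move: (wrap L x) xL => {}x xL.
rewrite -row_free_unit -kermx_eq0; apply/negPn/negP => /rowV0Pn[v /sub_kermxP vW v0].
pose p t := v *m (N t x *m Ba t x).
pose phi t := (v *m W t x *m v^T) 0 0.
have dphi t : 0 <= t <= T ->
    isder `[0, T] phi t (eta t x * \sum_j p t 0 j ^+ 2).
  move=> tT; have := mderM (mderM (mder_cst `[0, T] v t) (@dW t x tT)) (mder_cst `[0, T] v^T t).
  move=> /(_ 0 0); rewrite mul0mx add0r mulmx0 addr0.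
  rewrite -scalemxAr -scalemxAl mxE.
  congr (isder _ _ _ (_ * _)).
  rewrite trmx_mul !mulmxA -/(p t).
  rewrite (_ : _ *m v^T = p t *m (p t)^T); last first.
    by rewrite /p !trmx_mul !mulmxA.
  by rewrite mxE; apply: eq_bigr => j _; rewrite [_^T _ _]mxE expr2.
have eta0 t : 0 <= eta t x by exact: bump_per_ge0.
have p2 t : 0 <= \sum_j p t 0 j ^+ 2 by apply: sumr_ge0 => j _; exact: sqr_ge0.
have phi0 t : 0 <= t <= T -> phi t = 0.
  move=> /andP[t0 tT].
  have dphi0 s : 0 <= s <= T -> 0 <= eta s x * \sum_j p s 0 j ^+ 2.
    by move=> _; rewrite mulr_ge0.
  have h1 := isder_ge0_homo dphi dphi0 (lexx 0) t0 tT.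
  have h2 := isder_ge0_homo dphi dphi0 t0 tT (lexx T).
  have e0 : phi 0 = 0 by rewrite /phi W0 mulmx0 mul0mx mxE.
  have eT : phi T = 0 by rewrite /phi vW mul0mx mxE.
  by apply/eqP; rewrite eq_le; apply/andP; split; [rewrite -eT|rewrite -e0].
have etap t : 0 <= t <= T -> eta t x * \sum_j p t 0 j ^+ 2 = 0.
  move=> tT; apply: (isder_seg_uniq T0 tT (dphi t tT)).
  apply: (@isder_eq _ _ (fun=> 0)) (isder_cst _ _ _).
    by rewrite /= in_itv.
  by move=> s; rewrite /= in_itv /= => /phi0 ->.
have p0 t : 0 <= t <= T -> active_times T L a b x t -> p t = 0.
  move=> tT act; apply/rowP => j; rewrite [RHS]mxE; apply: contrapT => /eqP pt.
  have cp : continuous (fun t => p t 0 j).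
    have [cB _ _ _ _] := C1per_rect_c01 T0 L0 hB; have [cN' _ _ _ _] := cN.
    have cv : jcontmx (fun _ (_ : R) => v) by exact: jcontmx_cst.
    have cvNB : jcontmx (fun t x => v *m (N t x *m Ba t x)).
      by apply: jcontmxM => //; exact: jcontmxM.
    exact: (@jcont_slice _ _ (fun t x => (v *m (N t x *m Ba t x)) 0 j) x (cvNB 0 j)).
  have [|d d0 Hd] := continuous_neq0 cp (c := t); first exact: pt.
  have [s [sT sd [k kab]]] := active_closure T0 L0 hab xL tT act d0.
  have es : eta s x > 0.
    by rewrite /along_bump /along /ext clamp_id// mul1r; apply: bump_per_gt0 kab.
  have := etap s sT => /eqP; rewrite mulf_eq0 gt_eqF//=.
  rewrite psumr_eq0; last by move=> i _; exact: sqr_ge0.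
  by move=> /allP/(_ j (mem_index_enum j))/=; rewrite sqrf_eq0 (negPf (Hd s sd)).
(* [v N] annihilates [B psi], so [v N z] is constant; steering 0 to
   [M(T) v^T] then gives [v v^T = 0]. *)
have [psi [_ psi0] [z [dz z0 zT]]] := H x xL 0 (M T x *m v^T).
have vz : v *m (N T x *m z T) = 0.
  have := @mder0_cst R 1 1 T (fun t => v *m (N t x *m z t)) T.
  rewrite z0 !mulmx0; apply=> // t tT.
  have tT' : t \in `[0, T] by rewrite in_itv.
  have [dzt ezt] := dz t tT'.
  have := derivable_mder dzt; rewrite ezt.
  have perF (p' q' : nat) (F : R -> R -> 'M[R]_(p', q')) : C1per_rect T L F ->
      F t (Xbar T L t x) = along T L F t x.
    move=> cF; rewrite /along clamp_id// mul1r (ext_Xbar T0 L0)// => s sT.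
    exact: C1per_rect_per cF sT.
  rewrite (perF _ _ _ hA) (perF _ _ _ hB) => dzt'.
  have := mderM (mder_cst `[0, T] v t) (mderM (@dN t x tT) dzt').
  have -> : 0 *m (N t x *m z t) + v *m (- (N t x *m - Aa t x) *m z t +
      N t x *m (- Aa t x *m z t + Ba t x *m psi t)) = p t *m psi t.
    rewrite mul0mx add0r mulmxN opprK mulmxDr mulNmx mulmxN !mulmxA addrA.
    by rewrite subrr add0r /p !mulmxA.
  have [act|nact] := pselect (active_times T L a b x t); first by rewrite p0// mul0mx.
  by rewrite psi0 ?mulmx0.
move: vz; rewrite zT; have [NM1 _] := @NM T x TT.
rewrite (mulmxA (N T x)) NM1 mul1mx => /matrixP/(_ 0 0); rewrite !mxE => /eqP.
rewrite psumr_eq0; last by move=> i _; rewrite mxE -expr2 sqr_ge0.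
move=> /allP vv; move/eqP: v0; apply; apply/rowP => j; rewrite mxE.
have := vv j (mem_index_enum j) => /=; rewrite mxE -expr2 sqrf_eq0.
by move/eqP.
Qed.

Lemma ode_controllable_exactly_aux :
  (forall x : R, 0 <= x < L ->
     ode_controllable T (fun t => - A t (Xbar T L t x))
       (fun t => B t (Xbar T L t x)) (ode_controls T L a b x)) ->
  exactly_controllable T L a b A B.
Proof.
move=> H y0 y1 cy0 cy1.
have uW x : W T x \in unitmx by exact: gramian_unit.
(* The target is read at [x + T], where the characteristic issued from x arrives. *)
pose Y0 := per L y0; pose Y1 x := per L y1 (x + T).
pose D x := invmx (W T x) *m (N T x *m Y1 x - Y0 x).
pose U t x := eta t x *: ((N t x *m Ba t x)^T *m D x).
(* Variation of constants: since [W' D = N Ba U], the integral of [N Ba U] is [W D]. At time [T] the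
   bracket equals [N(T) Y1], so [Z] ends at [Y1]. *)
pose Z t x := M t x *m (Y0 x + W t x *m D x).
have [cAa _ _ _ _] := C1per_rect_c01 T0 L0 hA.
have [cBa _ _ _ _] := C1per_rect_c01 T0 L0 hB.
have [jM _ _ _ _] := cM; have [jN _ _ _ _] := cN.
have ceta : c1 T eta by do 2 eexists; exact: (along_bump_c1s T0 L0 ha hab hb).
have [jeta _ _ _ _] := along_bump_c1s T0 L0 ha hab hb.
have cM1 : c1mx T M by apply: (c01_c1mx cM _ dM); exact: jcontmxM (jcontmxN cAa) jM.
have cN1 : c1mx T N by apply: (c01_c1mx cN _ dN); exact: jcontmxN (jcontmxM jN (jcontmxN cAa)).
have cW1 : c1mx T W.
  apply: (c01_c1mx cW _ dW); apply: jcontmxZ => //.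
  by apply: jcontmxM; [exact: jcontmxM|apply: jcontmx_tr; exact: jcontmxM].
have cY0 : c1mx T (fun _ => Y0) by exact: C1per_seg_c1mx.
have cY1 : c1mx T (fun _ => Y1).
  by apply: (c1mx_shift (F := fun _ => per L y1)); exact: C1per_seg_c1mx.
have cD : c1mx T (fun _ => D).
  apply: c1mxM; first by apply: c1mx_inv => //; exact: (c01_c1mx_at T T cW).
  by apply: c1mxD; [apply: c1mxM => //; exact: (c01_c1mx_at T T cN)|exact: c1mxN].
have cBa1 : c1mx T Ba by apply: c1mx_shear; exact: C1per_rect_c1mx.
have cU : c1mx T U.
  by apply: c1mxZ => //; apply: c1mxM => //; apply: c1mx_tr; exact: c1mxM.
have cZ : c1mx T Z by apply: c1mxM => //; apply: c1mxD => //; exact: c1mxM.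
have dZ t x : 0 <= t <= T ->
    mder `[0, T] (Z^~ x) t (- Aa t x *m Z t x + Ba t x *m U t x).
  move=> tT; have [_ MN] := @NM t x tT.
  have := mderM (@dM t x tT) (mderD (mder_cst `[0, T] (Y0 x) t)
     (mderM (@dW t x tT) (mder_cst `[0, T] (D x) t))).
  rewrite -mulmxA -/(Z t x) add0r mulmx0 addr0 -scalemxAl.
  rewrite -scalemxAr /U -scalemxAr !mulmxA MN mul1mx.
  by rewrite -!mulmxA.
have Y0L x : Y0 (x + L) = Y0 x by rewrite /Y0 /per (wrap_period L0).
have Y1L x : Y1 (x + L) = Y1 x by rewrite /Y1 /per addrAC (wrap_period L0).
have DL x : D (x + L) = D x.
  have xx := wrap_period L0 x.
  by rewrite /D Y0L Y1L (W_wrap xx TT) (N_wrap xx TT).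
have UL t x : 0 <= t <= T -> U t (x + L) = U t x.
  move=> tT; have xx := wrap_period L0 x.
  rewrite /U DL (N_wrap xx tT) (along_wrap T L0 B t xx).
  by rewrite /along_bump (along_wrap T L0 _ t xx).
have ZL t x : 0 <= t <= T -> Z t (x + L) = Z t x.
  move=> tT; have xx := wrap_period L0 x.
  by rewrite /Z DL Y0L (M_wrap xx tT) (W_wrap xx tT).
(* Back to positions: the characteristic through x at time t started at [x - t]. *)
pose Th t x := U t (x + -1 * clamp T t); pose y t x := Z t (x + -1 * clamp T t).
have xback t x : x + -1 * clamp T t + 1 * clamp T t = x by ring.
have alongE (V : Type) (F : R -> R -> V) t x : 0 <= t <= T -> 0 <= x <= L ->
    (forall t, 0 <= t <= T -> F t 0 = F t L) ->
    along T L F t (x + -1 * clamp T t) = F t x.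
  by move=> tT xL F0; rewrite /along xback ext_id// F0.
exists Th; split.
- apply: (c1mx_C1per_rect T0 L0 (c1mx_shear (-1) cU)) => t x tT.
  by rewrite addrAC UL.
- rewrite /control_support (closure_id (`[0, T] `*` `[a, b])).1; last first.
    apply: compact_closed; last by apply: compact_setX; exact: segment_compact.
    exact: norm_hausdorff.
  apply: closureS => -[t x] /= [[/= tT xL] Tx]; split=> //=.
  move: tT xL; rewrite !in_itv /= => tT xL.
  apply: (bump_neq0 ha hab hb); apply/eqP => bx; apply: Tx.
  have eta0 : eta t (x + -1 * clamp T t) = 0.
    by rewrite /along_bump /along xback /ext (bump_per L0 ha hab hb xL).
  by rewrite /Th /U eta0 scale0r.
exists y; split.
- apply: (c1mx_C1per_rect T0 L0 (c1mx_shear (-1) cZ)) => t x tT.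
  by rewrite addrAC ZL.
- split.
  + move=> t x; rewrite !in_itv /= => tT xL.
    have yE : d_t T y t x + d_x L y t x =
        - Aa t (x + -1 * clamp T t) *m y t x + Ba t (x + -1 * clamp T t) *m Th t x.
      apply/matrixP => i j; rewrite mxE.
      have [gt [gx cg]] := cZ i j; have [_ _ _ dgt _] := cg.
      have [_ _ _ dyt dyx] := c1s_shear (-1) cg.
      rewrite [d_t _ _ _ _ _ _]mxE [d_x _ _ _ _ _ _]mxE.
      rewrite (derive_inE T0 tT (dyt t x tT)).
      rewrite (derive_inE L0 xL (isder_subset (@subsetT _ _) (dyx t x))).
      (* Under the shear of speed -1 the time derivative is [gt - gx]; adding the x-derivative [gx]
         leaves [gt], the derivative along the characteristic, which the ODE for [Z] identifies. *)
      have addNK u v : u + -1 * v + v = u :> R by ring.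
      rewrite addNK; apply: (isder_seg_uniq T0 tT (dgt t _ tT)).
      exact: dZ.
    rewrite yE !alongE//; first by rewrite mulNmx addrAC addNr add0r.
      by move=> s; exact: C1per_rect_per.
    by move=> s; exact: C1per_rect_per.
  + by move=> t; rewrite in_itv /= => tT; rewrite /y -[in LHS](add0r L) addrAC ZL.
  + move=> x; rewrite in_itv /= => xL; have [_ y0L _] := cy0.
    rewrite /y clamp_id ?lexx ?ltW// mulr0 addr0 /Z M0 W0 mul1mx mul0mx addr0.
    by rewrite /Y0 (perE L0 y0L (k := 0)) ?mul0r ?subr0.
- move=> x xL; have [_ y1L _] := cy1.
  rewrite /y /Z /D (mulmxA (W T _)) mulmxV// mul1mx (addrC (Y0 _)) subrK mulmxA.
  have [_ ->] := @NM T (x + -1 * clamp T T) TT.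
  rewrite mul1mx /Y1 clamp_id// mulN1r subrK (perE L0 y1L (k := 0)) ?mul0r ?subr0//.
Qed.

End Sufficiency.

Lemma ode_controllable_exactly (R : realType) (T L : R) (n m : nat) (a b : R)
    (A : R -> R -> 'M[R]_n) (B : R -> R -> 'M[R]_(n, m)) :
  0 < T -> 0 < L -> C1per_rect T L A -> C1per_rect T L B ->
  0 <= a -> a < b -> b <= L ->
  (forall x : R, 0 <= x < L ->
     ode_controllable T (fun t => - A t (Xbar T L t x))
       (fun t => B t (Xbar T L t x)) (ode_controls T L a b x)) ->
  exactly_controllable T L a b A B.
Proof.
move=> T0 L0 hA hB ha hab hb.
have [M [N [W [[[Mx cM] [Nx cN] [Wx cW]] [M0 N0 W0] [dM dN dW] NM]]]] :=
  propagators T0 L0 hA hB ha hab hb.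
exact: (@ode_controllable_exactly_aux R T L T0 L0 n m a b A B hA hB ha hab hb
  M N W M0 N0 W0 dM dN dW NM Mx Nx Wx cM cN cW).
Qed.

Theorem theorem2p2 (R : realType) (n m : nat) (hn : (0 < n)%N) (hm : (0 < m)%N)
    (T L a b : R) (hT : 0 < T) (hL : 0 < L)
    (ha : 0 <= a) (hab : a < b) (hb : b <= L)
    (A : R -> R -> 'M[R]_n) (B : R -> R -> 'M[R]_(n, m))
    (hA : C1per_rect T L A) (hB : C1per_rect T L B) :
  exactly_controllable T L a b A B <->
  (T > L - (b - a) /\
   forall x : R, 0 <= x < L ->
     ode_controllable T (fun t => - A t (Xbar T L t x))
       (fun t => B t (Xbar T L t x)) (ode_controls T L a b x)).
Proof.
split=> [H|[_ H]]; last exact: ode_controllable_exactly.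
have Hx x (xL : 0 <= x < L) := exactly_controllable_ode hT hL ha hab hb H xL.
by split=> //; exact: ode_controllable_time Hx.
Qed.
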